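(* Let $c,\alpha,\beta\in(0,1)$. The set of all $f\in\mathcal{L}(c,\alpha,\beta)$ such that $$h_{top}(f)=\sup\Big\{h_{\mu}(f)\,;\,\mu\in\mathcal{M}^1(f),\ \int\log f'\,d\mu\ge\lambda\Big\}\quad\text{for every }\lambda>0$$ is a residual subset of $\mathcal{L}(c,\alpha,\beta)$ (with respect to the metric $\operatorname{dist}$).
   Context: $C^{1+}$ means $C^1$ with Hölder continuous derivative; a Hölder exponent $\rho\in(0,1)$ is fixed, $C^{1+}=C^{1+\rho}$ (locally, for maps on $[0,1]\setminus\{c\}$), and $\|\varphi\|_{C^{1+}}=\sup|\varphi|+\sup|\varphi'|+\sup_{x\ne y}\frac{|\varphi'(x)-\varphi'(y)|}{|x-y|^{\rho}}$. Expanding Lorenz map: for $0<c<1$, a $C^{1+}$ map $f:[0,1]\setminus\{c\}\to[0,1]$ such that $f(0)=0$, $f(1)=1$, there is a constant $\sigma>1$ with $f'(x)\ge\sigma$ for all $x\in[0,1]\setminus\{c\}$, and $f'(c_-)=f'(c_+)=+\infty$. The point $c$ is called the singularity. Here $f'(c_-)=\lim_{x\uparrow c}f'(x)$, $f'(c_+)=\lim_{x\downarrow c}f'(x)$, $f(c_-)=\lim_{x\uparrow c}f(x)$, $f(c_+)=\lim_{x\downarrow c}f(x)$. $\mathcal{L}(c,\alpha,\beta)$: the set of all expanding Lorenz maps $f$ with singularity $c$ for which there are $d_0,d_1\in[0,1]$ and $C^{1+}$ diffeomorphisms $\phi_{0,f}:[0,c]\to[0,d_0^{1/\alpha}]$,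 $\phi_{1,f}:[c,1]\to[0,d_1^{1/\beta}]$ with $\phi_{0,f}(c)=\phi_{1,f}(c)=0$, $\phi_{0,f}(0)=d_0^{1/\alpha}$, $\phi_{1,f}(1)=d_1^{1/\beta}$, such that $f(x)=d_0-(\phi_{0,f}(x))^{\alpha}$ for $x<c$ and $f(x)=1-d_1+(\phi_{1,f}(x))^{\beta}$ for $x>c$ (so $f(c_-)=d_0$, $f(c_+)=1-d_1$). The metric is $$\operatorname{dist}(f,g)=|f(c_-)-g(c_-)|+|f(c_+)-g(c_+)|+\|\phi_{0,f}-\phi_{0,g}\|_{C^{1+}}+\|\phi_{1,f}-\phi_{1,g}\|_{C^{1+}}.$$ Residual means containing a countable intersection of open dense subsets. $\mathcal{M}^1(f)$ is the set of all $f$-invariant Borel probabilities $\mu$ on $[0,1]$, i.e. $\mu(f^{-1}(B))=\mu(B)$ for all Borel $B\subset[0,1]$, where $f^{-1}(B)\subset[0,1]\setminus\{c\}$ (so $\mu(\{c\})=0$). $h_\mu(f)$ is the metric entropy, and $h_{top}(f)$ the topological entropy of $f$, with $h_{top}(f)=\sup\{h_\mu(f)\,;\,\mu\in\mathcal{M}^1(f)\}$ (variational principle). The value $\int\log f'\,d\mu=+\infty$ is allowed. *)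

(* Defs.v *)
From HB Require Import structures.
From mathcomp Require Import all_boot all_order all_algebra.
From mathcomp Require Import all_classical all_reals all_analysis.
From mathcomp Require Import ring lra.

Set Implicit Arguments.
Unset Strict Implicit.
Unset Printing Implicit Defensive.

Import Order.TTheory GRing.Theory Num.Theory.
Import numFieldNormedType.Exports.

Local Open Scope classical_set_scope.
Local Open Scope ring_scope.

Section holder_calculus.
Context {R : realType}.
Implicit Types (A B : set R) (rho : R) (f g phi psi : R -> R).

(* One-sided at the endpoints when A is a compact interval. *)
Definition derivable_on A f (x : R) : Prop :=
  cvg ((f y - f x) / (y - x) @[y --> within A x^']).

Definition deriv_on A f (x : R) : R :=
  lim ((f y - f x) / (y - x) @[y --> within A x^']).

Definition holder_on rho A g : Prop :=
  exists K : R, forall x y, A x -> A y -> `|g x - g y| <= K * `|x - y| `^ rho.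

Definition C1holder rho A f : Prop :=
  (forall x, A x -> derivable_on A f x) /\ holder_on rho A (deriv_on A f).

Definition C1holder_loc rho A f : Prop :=
  (forall x, A x -> derivable_on A f x) /\
  (forall x, A x -> exists2 e, 0 < e &
     holder_on rho (A `&` ball x e) (deriv_on A f)).

Definition C1holder_norm rho A phi : R :=
  sup [set `|phi x| | x in A]
  + sup [set `|deriv_on A phi x| | x in A]
  + sup [set `|deriv_on A phi p.1 - deriv_on A phi p.2| /
              `|p.1 - p.2| `^ rho
        | p in [set p : R * R | [/\ A p.1, A p.2 & p.1 != p.2]]].

Definition C1holder_diffeo rho A B phi : Prop :=
  [/\ C1holder rho A phi, set_bij A B phi &
   exists2 psi, (forall x, A x -> psi (phi x) = x) & C1holder rho B psi].

End holder_calculus.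

Section lorenz_maps.
Context {R : realType}.
Implicit Types (rho c alpha beta d : R) (f phi : R -> R).

Definition lorenz_dom c : set R := `[0, 1]%classic `\ c.

(* The values of f outside [0, 1] \ {c} carry no information: they are
   normalized to 0 so that equality in R -> R is equality of maps. *)
Record expanding_lorenz rho c f : Prop := {
  lorenz_sing : 0 < c < 1;
  lorenz_junk : forall x, ~ lorenz_dom c x -> f x = 0;
  lorenz_range : forall x, lorenz_dom c x -> 0 <= f x <= 1;
  lorenz_C1 : C1holder_loc rho (lorenz_dom c) f;
  lorenz_0 : f 0 = 0;
  lorenz_1 : f 1 = 1;
  lorenz_expanding : exists2 sigma, 1 < sigma &
    forall x, lorenz_dom c x -> sigma <= deriv_on (lorenz_dom c) f x;
  lorenz_deriv_left : deriv_on (lorenz_dom c) f x @[x --> c^'-] --> +oo;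
  lorenz_deriv_right : deriv_on (lorenz_dom c) f x @[x --> c^'+] --> +oo }.

Record left_branch rho c alpha f d phi : Prop := {
  left_branch_d : 0 <= d <= 1;
  left_branch_diffeo :
    C1holder_diffeo rho `[0, c]%classic `[0, d `^ alpha^-1]%classic phi;
  left_branch_sing : phi c = 0;
  left_branch_end : phi 0 = d `^ alpha^-1;
  left_branchE : forall x, 0 <= x < c -> f x = d - phi x `^ alpha }.

Record right_branch rho c beta f d phi : Prop := {
  right_branch_d : 0 <= d <= 1;
  right_branch_diffeo :
    C1holder_diffeo rho `[c, 1]%classic `[0, d `^ beta^-1]%classic phi;
  right_branch_sing : phi c = 0;
  right_branch_end : phi 1 = d `^ beta^-1;
  right_branchE : forall x, c < x <= 1 -> f x = 1 - d + phi x `^ beta }.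

(* The admissible range of the exponents is part of the class, so that the
   metric structure below is defined for all values of the parameters. *)
Record lorenz_class rho c alpha beta f : Prop := {
  lorenz_exponents : [/\ 0 < rho < 1, 0 < alpha < 1 & 0 < beta < 1];
  lorenz_expands : expanding_lorenz rho c f;
  lorenz_left : exists d phi, left_branch rho c alpha f d phi;
  lorenz_right : exists d phi, right_branch rho c beta f d phi }.

Record lorenz_map rho c alpha beta := LorenzMap {
  lorenz_fun :> R -> R;
  lorenz_mapP : lorenz_class rho c alpha beta lorenz_fun }.

Definition left_value c f : R := lim (f x @[x --> c^'-]).
Definition right_value c f : R := lim (f x @[x --> c^'+]).

(* The branch diffeomorphisms are determined by f on the intervals [0, c] and
   [c, 1]; nothing depends on their chosen values elsewhere. *)
Definition left_phi rho c alpha f : R -> R :=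
  get [set phi | exists d, left_branch rho c alpha f d phi].
Definition right_phi rho c beta f : R -> R :=
  get [set phi | exists d, right_branch rho c beta f d phi].

Definition lorenz_dist rho c alpha beta (f g : lorenz_map rho c alpha beta) :=
  `|left_value c f - left_value c g| + `|right_value c f - right_value c g|
  + C1holder_norm rho `[0, c]%classic
      (left_phi rho c alpha f \- left_phi rho c alpha g)
  + C1holder_norm rho `[c, 1]%classic
      (right_phi rho c beta f \- right_phi rho c beta g).

End lorenz_maps.

Section lorenz_metric.
Context {R : realType}.
Implicit Types (a b c d x rho alpha beta : R) (f g h phi psi : R -> R).

Let within_dnbhs_proper a b x : a < b -> `[a, b]%classic x ->
  ProperFilter (within `[a, b]%classic x^').
Proof.
move=> ab; rewrite /= in_itv/= => /andP[ax xb].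
apply: Build_ProperFilter_ex => P [e /= e0 Pe].
have [xltb|blex] := ltP x b.
  pose y := x + Num.min (e / 2) (b - x).
  have d0 : 0 < Num.min (e / 2) (b - x) by rewrite lt_min divr_gt0//= subr_gt0.
  exists y; apply: Pe => //=.
  - rewrite /y opprD addNKr normrN gtr0_norm//.
    by rewrite gt_min ltr_pdivrMr// ltr_pMr// ltr1n.
  - by rewrite /y gt_eqF// ltrDl.
  - rewrite in_itv/=; apply/andP; split; first by rewrite (le_trans ax)// lerDl ltW.
    by rewrite /y -lerBrDl ge_min lexx orbT.
have {}xb : x = b by apply/eqP; rewrite eq_le xb blex.
pose y := x - Num.min (e / 2) (b - a).
have d0 : 0 < Num.min (e / 2) (b - a) by rewrite lt_min divr_gt0//= subr_gt0.
exists y; apply: Pe => //=.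
- rewrite /y opprB addrC subrK gtr0_norm//.
  by rewrite gt_min ltr_pdivrMr// ltr_pMr// ltr1n.
- by rewrite /y lt_eqF// ltrBlDr ltrDl.
- rewrite in_itv/=; apply/andP; split.
    by rewrite /y lerBrDr -lerBrDl xb ge_min lexx orbT.
  by rewrite /y -xb lerBlDr lerDl ltW// xb.
Qed.

Let deriv_onB a b x phi psi : a < b -> `[a, b]%classic x ->
  derivable_on `[a, b] phi x -> derivable_on `[a, b] psi x ->
  deriv_on `[a, b] (phi \- psi) x = deriv_on `[a, b] phi x - deriv_on `[a, b] psi x.
Proof.
move=> ab abx dphi dpsi; have FF := within_dnbhs_proper ab abx.
apply: (@cvg_lim R) => //.
rewrite (_ : (fun y => _) = (fun y => (phi y - phi x) / (y - x)) \-
                            (fun y => (psi y - psi x) / (y - x))).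
  exact: cvgB.
by apply/funext => y /=; rewrite -mulrBl; congr (_ / _); ring.
Qed.

Let regular rho a b phi := C1holder rho `[a, b] phi /\
  exists M, forall x, `[a, b]%classic x -> `|phi x| <= M.

Let le_sup_image (T : Type) (E : set T) (F : T -> R) M t :
  (forall s, E s -> F s <= M) -> E t -> F t <= sup [set F s | s in E].
Proof.
move=> FM Et; apply: ub_le_sup; last by exists t.
by exists M => _ [s Es <-]; exact: FM.
Qed.

Let sup_image_le (T : Type) (E : set T) (F : T -> R) M :
  E !=set0 -> (forall s, E s -> F s <= M) -> sup [set F s | s in E] <= M.
Proof.
move=> [t Et] FM; apply: ge_sup; first by exists (F t); exists t.
by move=> _ [s Es <-]; exact: FM.
Qed.

Let sup_imageD (T : Type) (E : set T) (F G H : T -> R) M N :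
  E !=set0 -> (forall s, E s -> F s <= G s + H s) ->
  (forall s, E s -> G s <= M) -> (forall s, E s -> H s <= N) ->
  sup [set F s | s in E] <= sup [set G s | s in E] + sup [set H s | s in E].
Proof.
move=> E0 FGH GM HN; apply: sup_image_le => // s Es.
by rewrite (le_trans (FGH _ Es))// lerD//; apply: le_sup_image Es; eassumption.
Qed.

Let pairs a b : set (R * R) :=
  [set p | [/\ `[a, b]%classic p.1, `[a, b]%classic p.2 & p.1 != p.2]].

Let C1holder_normB rho a b phi psi : a < b ->
  regular rho a b phi -> regular rho a b psi ->
  C1holder_norm rho `[a, b] (phi \- psi) =
  sup [set `|phi x - psi x| | x in `[a, b]%classic]
  + sup [set `|deriv_on `[a, b] phi x - deriv_on `[a, b] psi x| | x in `[a, b]%classic]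
  + sup [set `|(deriv_on `[a, b] phi p.1 - deriv_on `[a, b] psi p.1) -
              (deriv_on `[a, b] phi p.2 - deriv_on `[a, b] psi p.2)| /
              `|p.1 - p.2| `^ rho | p in pairs a b].
Proof.
move=> ab [[dphi _] _] [[dpsi _] _]; rewrite /C1holder_norm.
congr (_ + sup _ + sup _).
  by apply: eq_imagel => x abx; rewrite deriv_onB//; [exact: dphi|exact: dpsi].
apply: eq_imagel => -[x y] [/= abx aby _].
by rewrite !deriv_onB//; [exact: dphi|exact: dpsi|exact: dphi|exact: dpsi].
Qed.

Let dom_neq0 a b : a < b -> `[a, b]%classic !=set0.
Proof. by move=> ab; exists a; rewrite /= in_itv/= lexx ltW. Qed.

Let pairs_neq0 a b : a < b -> pairs a b !=set0.
Proof.
move=> ab; exists (a, b); split => /=; last by rewrite lt_eqF.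
- by rewrite in_itv/= lexx ltW.
- by rewrite in_itv/= lexx ltW.
Qed.

Let bounded_fun rho a b phi psi : regular rho a b phi -> regular rho a b psi ->
  exists M, forall x, `[a, b]%classic x -> `|phi x - psi x| <= M.
Proof.
move=> [_ [M phiM]] [_ [N psiN]]; exists (M + N) => x abx.
by rewrite (le_trans (ler_normB _ _))// lerD ?phiM ?psiN.
Qed.

Let bounded_deriv1 rho a b phi : 0 < rho -> a < b -> regular rho a b phi ->
  exists M, forall x, `[a, b]%classic x -> `|deriv_on `[a, b] phi x| <= M.
Proof.
move=> rho0 ab [[_ [K phiK]] _].
exists (`|K| * (b - a) `^ rho + `|deriv_on `[a, b] phi a|) => x abx.
rewrite -lerBlDr (le_trans (lerB_dist _ _))//.
have aba : `[a, b]%classic a by rewrite /= in_itv/= lexx ltW.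
rewrite (le_trans (phiK _ _ abx aba))// (@le_trans _ _ (`|K| * `|x - a| `^ rho))//.
  by rewrite ler_wpM2r ?powR_ge0 ?ler_norm.
move: abx; rewrite /= in_itv/= => /andP[ax xb].
have xa0 : 0 <= x - a by rewrite subr_ge0.
rewrite (ger0_norm xa0) ler_wpM2l//; apply: ge0_ler_powR.
- exact: ltW.
- by rewrite nnegrE.
- by rewrite nnegrE subr_ge0 ltW.
- by rewrite lerB.
Qed.

Let bounded_deriv rho a b phi psi : 0 < rho -> a < b ->
  regular rho a b phi -> regular rho a b psi ->
  exists M, forall x, `[a, b]%classic x ->
    `|deriv_on `[a, b] phi x - deriv_on `[a, b] psi x| <= M.
Proof.
move=> rho0 ab /(bounded_deriv1 rho0 ab)[M phiM] /(bounded_deriv1 rho0 ab)[N psiN].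
exists (M + N) => x abx.
by rewrite (le_trans (ler_normB _ _))// lerD ?phiM ?psiN.
Qed.

Let bounded_quot rho a b phi psi :
  regular rho a b phi -> regular rho a b psi ->
  exists M, forall p, pairs a b p ->
    `|(deriv_on `[a, b] phi p.1 - deriv_on `[a, b] psi p.1) -
      (deriv_on `[a, b] phi p.2 - deriv_on `[a, b] psi p.2)| /
    `|p.1 - p.2| `^ rho <= M.
Proof.
move=> [[_ [K phiK]] _] [[_ [L psiL]] _].
exists (K + L) => -[x y] [/= abx aby xy].
rewrite ler_pdivrMr ?powR_gt0 ?normr_gt0 ?subr_eq0//.
set p := deriv_on _ phi; set q := deriv_on _ psi.
have -> : p x - q x - (p y - q y) = (p x - p y) - (q x - q y) by ring.
by rewrite mulrDl (le_trans (ler_normB _ _))// lerD ?phiK// psiL.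
Qed.

Let norm_ge0 rho a b phi psi : 0 < rho -> a < b ->
  regular rho a b phi -> regular rho a b psi ->
  [/\ 0 <= sup [set `|phi x - psi x| | x in `[a, b]%classic],
   0 <= sup [set `|deriv_on `[a, b] phi x - deriv_on `[a, b] psi x| | x in `[a, b]%classic]
  & 0 <= sup [set `|(deriv_on `[a, b] phi p.1 - deriv_on `[a, b] psi p.1) -
              (deriv_on `[a, b] phi p.2 - deriv_on `[a, b] psi p.2)| /
              `|p.1 - p.2| `^ rho | p in pairs a b]].
Proof.
move=> rho0 ab rphi rpsi; have [x abx] := dom_neq0 ab.
have [p abp] := pairs_neq0 ab.
have [M0 H0] := bounded_fun rphi rpsi.
have [M1 H1] := bounded_deriv rho0 ab rphi rpsi.
have [M2 H2] := bounded_quot rphi rpsi.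
split.
- exact: le_trans (le_sup_image H0 abx).
- exact: le_trans (le_sup_image H1 abx).
- by apply: le_trans (le_sup_image H2 abp); rewrite divr_ge0// powR_ge0.
Qed.

Let C1holder_normB_ge0 rho a b phi psi : 0 < rho -> a < b ->
  regular rho a b phi -> regular rho a b psi ->
  0 <= C1holder_norm rho `[a, b] (phi \- psi).
Proof.
move=> rho0 ab rphi rpsi; rewrite C1holder_normB//.
by have [? ? ?] := norm_ge0 rho0 ab rphi rpsi; rewrite !addr_ge0.
Qed.

Let C1holder_normBB rho a b phi : a < b -> regular rho a b phi ->
  C1holder_norm rho `[a, b] (phi \- phi) = 0.
Proof.
move=> ab rphi; rewrite C1holder_normB//.
have sup0 (T : Type) (E : set T) (F : T -> R) : E !=set0 ->
    (forall t, F t = 0) -> sup [set F t | t in E] = 0.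
  move=> [t Et] F0; rewrite (_ : [set _ | _ in _] = [set 0]) ?sup1//.
  by apply/seteqP; split => [_ [s _ <-]|_ ->] /=; [exact: F0|exists t].
rewrite !sup0 ?addr0//; [exact: pairs_neq0| |exact: dom_neq0| |exact: dom_neq0|].
- by move=> p; rewrite !subrr normr0 mul0r.
- by move=> x; rewrite subrr normr0.
- by move=> x; rewrite subrr normr0.
Qed.

Let C1holder_normBC rho a b phi psi : a < b ->
  regular rho a b phi -> regular rho a b psi ->
  C1holder_norm rho `[a, b] (phi \- psi) = C1holder_norm rho `[a, b] (psi \- phi).
Proof.
move=> ab rphi rpsi; rewrite !C1holder_normB//.
congr (sup _ + sup _ + sup _); apply: eq_imagel => p _; rewrite distrC//.
congr (`|_| / _); rewrite !opprB addrACA [RHS]addrC; ring.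
Qed.

Let C1holder_norm_triangle rho a b phi psi h : 0 < rho -> a < b ->
  regular rho a b phi -> regular rho a b psi -> regular rho a b h ->
  C1holder_norm rho `[a, b] (phi \- h) <=
  C1holder_norm rho `[a, b] (phi \- psi) + C1holder_norm rho `[a, b] (psi \- h).
Proof.
move=> rho0 ab rphi rpsi rh; rewrite !C1holder_normB//.
rewrite addrACA [X in _ <= X + _]addrACA.
have [M0 H0] := bounded_fun rphi rpsi; have [N0 K0] := bounded_fun rpsi rh.
have [M1 H1] := bounded_deriv rho0 ab rphi rpsi.
have [N1 K1] := bounded_deriv rho0 ab rpsi rh.
have [M2 H2] := bounded_quot rphi rpsi; have [N2 K2] := bounded_quot rpsi rh.
apply: lerD; first apply: lerD.
- apply: sup_imageD H0 K0; first exact: dom_neq0.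
  by move=> x _; exact: ler_distD.
- apply: sup_imageD H1 K1; first exact: dom_neq0.
  by move=> x _; exact: ler_distD.
- apply: sup_imageD H2 K2; first exact: pairs_neq0.
  move=> p _; rewrite -mulrDl ler_wpM2r ?invr_ge0 ?powR_ge0//.
  apply: le_trans (ler_normD _ _).
  by rewrite le_eqVlt; apply/orP; left; apply/eqP; congr (`|_|); ring.
Qed.

Let C1holder_norm_eq0 rho a b phi psi : 0 < rho -> a < b ->
  regular rho a b phi -> regular rho a b psi ->
  C1holder_norm rho `[a, b] (phi \- psi) = 0 ->
  forall x, `[a, b]%classic x -> phi x = psi x.
Proof.
move=> rho0 ab rphi rpsi; rewrite C1holder_normB// => n0 x abx.
have [p0 p1 p2] := norm_ge0 rho0 ab rphi rpsi.
have [M0 H0] := bounded_fun rphi rpsi.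
move: n0 => /eqP; rewrite !paddr_eq0 ?addr_ge0// => /andP[/andP[/eqP n0 _] _].
by apply/eqP; rewrite -subr_eq0 -normr_le0 -n0; exact: (le_sup_image H0).
Qed.

Let diffeo_regular rho a b d phi :
  C1holder_diffeo rho `[a, b]%classic `[0, d]%classic phi -> regular rho a b phi.
Proof.
move=> [C1 [phi_d _ _] _]; split=> //; exists d => x abx.
have : `[0, d]%classic (phi x) by apply: phi_d.
by rewrite /= in_itv/= => /andP[phi0 phid]; rewrite ger0_norm.
Qed.

Let branch_cvg (A : set R) c alpha phi (F : set_system R) :
  ProperFilter F -> 0 < alpha -> derivable_on A phi c -> phi c = 0 ->
  (forall x, A x -> 0 <= phi x) -> within A c^' `<=` F ->
  phi x `^ alpha @[x --> F] --> 0.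
Proof.
move=> FF alpha0 dphi phic phi0 AF.
have near_c : nbhs c `<=` F.
  move=> P cP; apply: AF; rewrite /within/= /dnbhs /within/=.
  by apply: (filterS _ cP) => y Py _ _.
have slope : (phi y - phi c) / (y - c) @[y --> F] --> deriv_on A phi c.
  by move=> P /dphi; exact: AF.
have yc : (y - c) @[y --> F] --> 0.
  by rewrite -(subrr c); apply: cvgB; [exact: near_c|exact: cvg_cst].
have {}phi_0 : phi y @[y --> F] --> 0.
  rewrite -(mulr0 (deriv_on A phi c)).
  apply: cvg_trans (cvgM slope yc); apply: near_eq_cvg.
  have : F [set y | y != c].
    apply: AF; rewrite /within/= /dnbhs /within/=.
    by apply: (@filterS _ (nbhs c) _ setT) => //; exact: filterT.
  apply: filterS => y /= ync.
  by rewrite phic subr0 divfK// subr_eq0.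
have FA : F A.
  apply: AF; rewrite /within/= /dnbhs /within/=.
  by apply: (@filterS _ (nbhs c) _ setT) => //; exact: filterT.
apply/cvgrPdist_lt => e e0.
have e'0 : 0 < e `^ alpha^-1 by rewrite powR_gt0.
move/cvgrPdist_lt : phi_0 => /(_ _ e'0).
apply: filterS2 FA => y Ay; rewrite !sub0r !normrN.
rewrite !ger0_norm ?powR_ge0 ?phi0// => phie.
have -> : e = (e `^ alpha^-1) `^ alpha.
  by rewrite -powRrM mulVf ?gt_eqF// powRr1// ltW.
by apply: gt0_ltr_powR; rewrite ?nnegrE ?powR_ge0 ?phi0.
Qed.

Let left_valueE rho c alpha f d phi : 0 < c -> 0 < alpha ->
  left_branch rho c alpha f d phi -> left_value c f = d.
Proof.
move=> c0 alpha0 [_ [[dphi _] [phi_d _ _] _] phic _ fE].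
apply: (@cvg_lim R) => //.
have cc : `[0, c]%classic c by rewrite /= in_itv/= lexx ltW.
have phi0 : phi x `^ alpha @[x --> c^'-] --> 0.
  apply: (branch_cvg _ alpha0 (dphi _ cc) phic) => [x /phi_d|].
    by rewrite /= in_itv/= => /andP[].
  move=> P [e /= e0 Pe]; near=> y; apply: Pe => //=.
  - have ce : c - e < y by near: y; apply: nbhs_left_gt; rewrite ltrBlDr ltrDl.
    have yc : y < c by [].
    by rewrite gtr0_norm; lra.

  - by rewrite in_itv/= ltW// ltW.
rewrite -[X in _ --> X](subr0 d).
apply: cvg_trans (cvgB (cvg_cst d) phi0); apply: near_eq_cvg.
by near=> y; rewrite /= fE// ltW//=.
Unshelve. all: by end_near. Qed.

Let right_valueE rho c beta f d phi : c < 1 -> 0 < beta ->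
  right_branch rho c beta f d phi -> right_value c f = 1 - d.
Proof.
move=> c1 beta0 [_ [[dphi _] [phi_d _ _] _] phic _ fE].
apply: (@cvg_lim R) => //.
have cc : `[c, 1]%classic c by rewrite /= in_itv/= lexx ltW.
have phi0 : phi x `^ beta @[x --> c^'+] --> 0.
  apply: (branch_cvg _ beta0 (dphi _ cc) phic) => [x /phi_d|].
    by rewrite /= in_itv/= => /andP[].
  move=> P [e /= e0 Pe]; near=> y; apply: Pe => //=.
  - have ce : y < c + e by near: y; apply: nbhs_right_lt; rewrite ltrDl.
    have yc : c < y by [].
    by rewrite ltr0_norm; lra.
  - by rewrite in_itv/= !ltW.
rewrite -[X in _ --> X](addr0 (1 - d)).
apply: cvg_trans (cvgD (cvg_cst (1 - d)) phi0); apply: near_eq_cvg.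
by near=> y; rewrite /= fE//; apply/andP; split => //; rewrite ltW.
Unshelve. all: by end_near. Qed.

Context {rho c alpha beta : R}.
Local Notation L := (lorenz_map rho c alpha beta).

HB.instance Definition _ := gen_eqMixin L.
HB.instance Definition _ := gen_choiceMixin L.

Let L_c (f : L) : 0 < c < 1.
Proof. exact: lorenz_sing (lorenz_expands (lorenz_mapP f)). Qed.

Lemma left_phiP (f : L) :
  exists d, left_branch rho c alpha f d (left_phi rho c alpha f).
Proof.
have [d [phi fphi]] := lorenz_left (lorenz_mapP f).
have := @getPex _ [set psi | exists e, left_branch rho c alpha f e psi].
by apply; exists phi, d.
Qed.

Lemma right_phiP (f : L) :
  exists d, right_branch rho c beta f d (right_phi rho c beta f).
Proof.
have [d [phi fphi]] := lorenz_right (lorenz_mapP f).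
have := @getPex _ [set psi | exists e, right_branch rho c beta f e psi].
by apply; exists phi, d.
Qed.

Lemma left_branch_phi (f : L) :
  left_branch rho c alpha f (left_value c f) (left_phi rho c alpha f).
Proof.
have [_ /andP[alpha0 _] _] := lorenz_exponents (lorenz_mapP f).
have /andP[c0 _] := L_c f.
by have [d fd] := left_phiP f; rewrite (left_valueE c0 alpha0 fd).
Qed.

Lemma right_branch_phi (f : L) :
  right_branch rho c beta f (1 - right_value c f) (right_phi rho c beta f).
Proof.
have [_ _ /andP[beta0 _]] := lorenz_exponents (lorenz_mapP f).
have /andP[_ c1] := L_c f.
by have [d fd] := right_phiP f; rewrite (right_valueE c1 beta0 fd) subKr.
Qed.

Let left_regular (f : L) : regular rho 0 c (left_phi rho c alpha f).
Proof. exact: diffeo_regular (left_branch_diffeo (left_branch_phi f)). Qed.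

Let right_regular (f : L) : regular rho c 1 (right_phi rho c beta f).
Proof. exact: diffeo_regular (right_branch_diffeo (right_branch_phi f)). Qed.

Let lorenz_distxx (f : L) : lorenz_dist f f = 0.
Proof.
have /andP[c0 c1] := L_c f.
by rewrite /lorenz_dist !subrr !normr0 !C1holder_normBB// !addr0.
Qed.

Let lorenz_dist_sym (f g : L) : lorenz_dist f g = lorenz_dist g f.
Proof.
have /andP[c0 c1] := L_c f.
rewrite /lorenz_dist distrC [`|right_value _ _ - _|]distrC.
by congr (_ + _ + _); exact: C1holder_normBC.
Qed.

Let lorenz_dist_triangle (g f h : L) :
  lorenz_dist f h <= lorenz_dist f g + lorenz_dist g h.
Proof.
have /andP[c0 c1] := L_c f.
have [/andP[rho0 _] _ _] := lorenz_exponents (lorenz_mapP f).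
rewrite /lorenz_dist [leRHS]addrACA; apply: lerD; last exact: C1holder_norm_triangle.
rewrite [leRHS]addrACA; apply: lerD; last exact: C1holder_norm_triangle.
by rewrite [leRHS]addrACA lerD// ler_distD.
Qed.

Let lorenz_dist_positivity (f g : L) : lorenz_dist f g = 0 -> f = g.
Proof.
have /andP[c0 c1] := L_c f.
have [/andP[rho0 _] _ _] := lorenz_exponents (lorenz_mapP f).
have sum0 (p q r s : R) : 0 <= p -> 0 <= q -> 0 <= r -> 0 <= s ->
    p + q + r + s = 0 -> [/\ p = 0, q = 0, r = 0 & s = 0].
  by move=> *; split; lra.
have Nl := C1holder_normB_ge0 rho0 c0 (left_regular f) (left_regular g).
have Nr := C1holder_normB_ge0 rho0 c1 (right_regular f) (right_regular g).
move=> /(sum0 _ _ _ _ (normr_ge0 _) (normr_ge0 _) Nl Nr)[].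
move=> /normr0_eq0/subr0_eq leq /normr0_eq0/subr0_eq req lphi rphi.
have [_ _ _ _ flE] := left_branch_phi f; have [_ _ _ _ glE] := left_branch_phi g.
have [_ _ _ _ frE] := right_branch_phi f; have [_ _ _ _ grE] := right_branch_phi g.
have fg : f = g :> (R -> R).
  apply/funext => x; have [domx|domx] := pselect (lorenz_dom c x); last first.
    by rewrite !(lorenz_junk (lorenz_expands (lorenz_mapP _))).
  have [] := domx; rewrite /= in_itv/= => /andP[x0 x1] xc.
  have [{}xc|cx|//] := ltgtP x c.
    rewrite flE ?x0// glE ?x0// leq; congr (_ - _ `^ _).
    apply: (C1holder_norm_eq0 rho0 c0 (left_regular f) (left_regular g) lphi).
    by rewrite /= in_itv/= x0 ltW.
  rewrite frE ?cx// grE ?cx// req; congr (_ + _ `^ _).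
  apply: (C1holder_norm_eq0 rho0 c1 (right_regular f) (right_regular g) rphi).
  by rewrite /= in_itv/= x1 ltW.
case: f g fg {Nl Nr leq req lphi rphi flE glE frE grE} => [f Pf] [g Pg] /= fg.
by rewrite fg in Pf *; congr LorenzMap; exact: Prop_irrelevance.
Qed.

HB.instance Definition _ := isMetric.Build R L
  lorenz_distxx lorenz_dist_positivity lorenz_dist_sym lorenz_dist_triangle.

End lorenz_metric.

Lemma open_lorenzP {R : realType} (rho c alpha beta : R)
    (U : set (lorenz_map rho c alpha beta)) :
  open U <-> forall f, U f ->
    exists2 e, 0 < e & forall g, lorenz_dist f g < e -> U g.
Proof.
rewrite openE; split => [oU f /oU|oU f /oU [e e0 eU]].
  by move=> /nbhs_ballP[e /= e0 eU]; exists e.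
by apply/nbhs_ballP; exists e.
Qed.

Definition residual {T : topologicalType} (S : set T) : Prop :=
  exists2 U : (set T)^nat, (forall n, open (U n) /\ dense (U n)) &
    \bigcap_n U n `<=` S.

Section entropy.
Context {R : realType}.
Implicit Types (c : R) (f : R -> R) (B : set R).
Implicit Types mu : probability (measurableTypeR R) R.

Definition lorenz_preimage c f B : set R := lorenz_dom c `&` f @^-1` B.

Definition invariant_probability c f mu : Prop :=
  mu `[0, 1]%classic = 1%E /\
  forall B : set (measurableTypeR R), measurable B -> B `<=` `[0, 1] ->
    mu (lorenz_preimage c f B) = mu B.

Definition measurable_partition k (P : 'I_k -> set (measurableTypeR R)) : Prop :=
  [/\ forall i, measurable (P i), trivIset setT P &
      \bigcup_i P i = `[0, 1]%classic].

(* P \/ f^-1 P \/ ... \/ f^-(n-1) P, its atoms indexed by words of length n. *)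
Definition refined_partition c f k (P : 'I_k -> set R) n
    (w : {ffun 'I_n -> 'I_k}) : set R :=
  \bigcap_(i in [set: 'I_n]) iter i (lorenz_preimage c f) (P (w i)).

(* Empty or null atoms contribute 0, because ln 0 = 0. *)
Definition partition_entropy mu (I : finType) (P : I -> set R) : R :=
  - \sum_i fine (mu (P i)) * ln (fine (mu (P i))).

Definition entropy_wrt c f mu k (P : 'I_k -> set R) : R :=
  limn (fun n : nat =>
    n%:R^-1 * partition_entropy mu (refined_partition c f P (n := n))).

Definition metric_entropy c f mu : \bar R :=
  ereal_sup [set h | exists k (P : 'I_k -> set R),
    measurable_partition P /\ h = (entropy_wrt c f mu P)%:E].

(* f is neither continuous nor everywhere defined: its topological entropy is
   the one given by the variational principle. *)
Definition topological_entropy c f : \bar R :=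
  ereal_sup [set metric_entropy c f mu
            | mu in [set mu | invariant_probability c f mu]].

Definition lyapunov_exponent c f mu : \bar R :=
  (\int[mu]_(x in lorenz_dom c) (ln (deriv_on (lorenz_dom c) f x))%:E)%E.

End entropy.

(* Main.v *)
Require Import Defs.
From mathcomp Require Import all_boot all_order all_algebra.
From mathcomp Require Import all_classical all_reals all_analysis.
From mathcomp Require Import measurable_realfun.
From mathcomp Require Import ring lra.

Set Implicit Arguments.
Unset Strict Implicit.
Unset Printing Implicit Defensive.

Import Order.TTheory GRing.Theory Num.Theory.
Import numFieldNormedType.Exports.

Local Open Scope classical_set_scope.
Local Open Scope ring_scope.

(** Since [log f' > 0], it suffices that a generic [f] has periodic orbits of
    arbitrarily large Lyapunov exponent. Indeed let [nu] be the invariant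
    probability carried by such an orbit, and [mu] any invariant probability. For
    a finite partition, the entropies of [(1 - t) mu + t nu] and of [mu]
    multiplied by [1 - t] differ by at most a constant independent of it, for
    the atoms missed by the orbit scale exactly and at most [n] atoms are visited
    ([partition_entropy_mixture]). Hence the mixture has at least [1 - t] times the
    entropy of [mu] along every partition, while its exponent is at least [t] times
    that of [nu], which is as large as wanted. Letting [t] go to 0 gives the claim
    ([high_periodic_entropy]).

    Genericity of such orbits is obtained in the interior of the set of maps with
    a periodic orbit of exponent at least [K], which is open, and dense by
    [high_periodic_perturbation]. Given [f], multiply its left branch by a factor
    [s] slightly smaller than 1. In this family the singular value [f(c-)] must
    fall on [c] after some time [n], for arbitrarily small perturbations: otherwise
    its iterates for two parameters would follow the same branches for ever and
    separate exponentially ([scale_left_connection]). Let [g] be a map with such a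
    connection. If [h] is close to [g] and the singular value of [h] returns at
    time [n] slightly beyond [c] (which is an open condition, satisfied when [s]
    is increased a little), then the [n]-th iterate of [h] maps a short interval
    [c - r, c] across itself, and has a fixed point [p < c] there
    ([connection_high_periodic]). As [r] goes to 0 the derivative [h'(p)] tends to
    infinity, uniformly for [h] close to [g] ([left_deriv_near]), whereas [n] does
    not change; so the exponent of the orbit of [p] is as large as wanted. *)

(** * Derivatives relative to a set *)

Section one_sided_derivatives.
Context {R : realType}.
Implicit Types (A B : set R) (f g : R -> R) (x y k l : R).

(** [x] is a limit point of [A], so that the filter [within A x^'] is proper. *)
Definition limit_point_of A x :=
  forall d : R, 0 < d -> exists y, [/\ A y, y != x & `|y - x| < d].

Lemma slope_cvgP A f x l :
  (f y - f x) / (y - x) @[y --> within A x^'] --> l <->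
  forall e : R, 0 < e -> exists2 d : R, 0 < d & forall y, A y -> y != x ->
    `|y - x| < d -> `|(f y - f x) / (y - x) - l| < e.
Proof.
split=> [/cvgrPdist_lt fl e e0|fl].
  have [d /= d0 fd] := fl _ e0.
  exists d => // y Ay yx yxd; rewrite distrC; apply: fd => //=.
  by rewrite distrC.
apply/cvgrPdist_lt => e e0; have [d d0 fd] := fl _ e0.
exists d => //= y yxd yx Ay; rewrite distrC; apply: fd => //.
by rewrite distrC.
Qed.

Lemma limit_point_proper A x : limit_point_of A x -> ProperFilter (within A x^').
Proof.
move=> acc; apply: Build_ProperFilter_ex => P [e /= e0 Pe].
by have [y [Ay yx ye]] := acc _ e0; exists y; apply: Pe => //=; rewrite distrC.
Qed.

Lemma deriv_on_cvg A f x : derivable_on A f x ->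
  (f y - f x) / (y - x) @[y --> within A x^'] --> deriv_on A f x.
Proof. by []. Qed.

Lemma cvg_deriv_on A f x l : limit_point_of A x ->
  (f y - f x) / (y - x) @[y --> within A x^'] --> l ->
  derivable_on A f x /\ deriv_on A f x = l.
Proof.
move=> /limit_point_proper FF fl; split; first by apply/cvg_ex; exists l.
exact: (@cvg_lim R).
Qed.

(** Derivatives depend on germs only, and scale: it suffices that near [x] the
    set [A] is contained in [B] and [f] is [k] times [g] on [A]. *)
Lemma deriv_on_germ A B f g k x : A x -> limit_point_of A x ->
  (exists2 r : R, 0 < r & forall y, `|y - x| < r -> A y -> B y /\ f y = k * g y) ->
  derivable_on B g x ->
  derivable_on A f x /\ deriv_on A f x = k * deriv_on B g x.
Proof.
move=> Ax acc [r r0 fg] /deriv_on_cvg/slope_cvgP gl.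
apply: cvg_deriv_on => //; apply/slope_cvgP => e e0.
have k0 : 0 < `|k| + 1 by rewrite ltr_wpDl.
have [d d0 gd] := gl _ (divr_gt0 e0 k0).
exists (Num.min r d); first by rewrite lt_min r0.
move=> y Ay yx; rewrite lt_min => /andP[yr yd].
have [By ->] := fg _ yr Ay.
have [_ ->] : B x /\ f x = k * g x by apply: fg; rewrite ?subrr ?normr0.
have /= gdy := gd _ By yx yd.
rewrite -mulrBr -mulrA -mulrBr normrM.
apply: (@le_lt_trans _ _ (`|k| * (e / (`|k| + 1)))).
  by rewrite ler_wpM2l// ltW.
by rewrite mulrA ltr_pdivrMr// mulrC ltr_pM2l// ltrDl.
Qed.

Lemma deriv_onB A f g x : limit_point_of A x ->
  derivable_on A f x -> derivable_on A g x ->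
  deriv_on A (f \- g) x = deriv_on A f x - deriv_on A g x.
Proof.
move=> /limit_point_proper FF df dg; apply: (@cvg_lim R) => //.
rewrite (_ : (fun y => _) = (fun y => (f y - f x) / (y - x)) \-
                            (fun y => (g y - g x) / (y - x))).
  exact: cvgB.
by apply/funext => y /=; rewrite -mulrBl; congr (_ / _); ring.
Qed.

Lemma derivable_on_continuous A f x : derivable_on A f x ->
  forall e : R, 0 < e -> exists2 d : R, 0 < d & forall y, A y ->
    `|y - x| < d -> `|f y - f x| < e.
Proof.
move=> /deriv_on_cvg/slope_cvgP fl e e0.
set l := deriv_on A f x in fl.
have l0 : 0 < `|l| + 1 by rewrite ltr_wpDl.
have [d d0 fd] := fl _ ltr01.
exists (Num.min d (e / (`|l| + 1))); first by rewrite lt_min d0 divr_gt0.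
move=> y Ay; rewrite lt_min => /andP[yd ye].
have [->|yx] := eqVneq y x; first by rewrite subrr normr0.
have q : `|(f y - f x) / (y - x)| <= `|l| + 1.
  rewrite -[X in `|X|](subrK l) addrC (le_trans (ler_normD _ _))// lerD2l ltW//.
  exact: fd.
have yx0 : y - x != 0 by rewrite subr_eq0.
rewrite -[f y - f x](divfK yx0) normrM.
apply: (@le_lt_trans _ _ ((`|l| + 1) * `|y - x|)); first by rewrite ler_wpM2r.
by rewrite mulrC -ltr_pdivlMr.
Qed.

Lemma deriv_on_ge A f x m : derivable_on A f x ->
  (forall d : R, 0 < d -> exists y, [/\ A y, y != x, `|y - x| < d &
    m <= (f y - f x) / (y - x)]) -> m <= deriv_on A f x.
Proof.
move=> /deriv_on_cvg/slope_cvgP fl fm.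
rewrite leNgt; apply/negP => lm.
have e0 : 0 < m - deriv_on A f x by rewrite subr_gt0.
have [d d0 fd] := fl _ e0.
have [y [Ay yx yd my]] := fm _ d0.
have := fd _ Ay yx yd; rewrite ltr_norml => /andP[_]; rewrite ltrD2r.
by rewrite ltNge my.
Qed.

Lemma derivable_on_is_derive A f x r : 0 < r ->
  (forall y, `|y - x| < r -> A y) -> derivable_on A f x ->
  is_derive x 1 f (deriv_on A f x).
Proof.
move=> r0 rA df.
have fl : (fun h => h^-1 *: ((f \o shift x) (h *: (1 : R^o)) - f x)) h
    @[h --> 0^'] --> deriv_on A f x.
  apply/cvgrPdist_lt => e e0.
  have /deriv_on_cvg/slope_cvgP/(_ _ e0)[d d0 fd] := df.
  exists (Num.min r d); first by rewrite /= lt_min r0.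
  move=> h /=; rewrite sub0r normrN lt_min => /andP[hr hd] h0.
  have -> : h *: (1 : R) = h by rewrite /GRing.scale /= mulr1.
  have := fd (h + x); rewrite addrK distrC => fdh.
  rewrite /GRing.scale/= mulrC; apply: fdh => //; first by apply: rA; rewrite addrK.
  by rewrite -subr_eq0 addrK.
have ? : derivable f x 1 by apply/cvg_ex; exists (deriv_on A f x).
by apply: DeriveDef => //; exact: (cvg_lim (@Rhausdorff R) fl).
Qed.

Lemma limit_point_itv (a b x : R) : a < b -> a <= x <= b ->
  limit_point_of `[a, b]%classic x.
Proof.
move=> ab /andP[ax xb] d d0; have [xltb|blex] := ltP x b.
  have m0 : 0 < Num.min (d / 2) (b - x) by rewrite lt_min divr_gt0//= subr_gt0.
  exists (x + Num.min (d / 2) (b - x)); split.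
  - rewrite /= in_itv/= -[_ <= b]lerBrDl ge_min lexx orbT andbT.
    by rewrite (le_trans ax)// lerDl ltW.
  - by rewrite gt_eqF// ltrDl.
  - by rewrite addrAC subrr add0r gtr0_norm// gt_min ltr_pdivrMr// ltr_pMr// ltr1n.
have xb' : x = b by apply/eqP; rewrite eq_le xb blex.
have m0 : 0 < Num.min (d / 2) (b - a) by rewrite lt_min divr_gt0//= subr_gt0.
exists (x - Num.min (d / 2) (b - a)); split.
- rewrite /= in_itv/= xb' gerBl (ltW m0) andbT lerBrDr -lerBrDl.
  by rewrite ge_min lexx orbT.
- by rewrite lt_eqF// gtrBl.
- by rewrite addrC addKr normrN gtr0_norm// gt_min ltr_pdivrMr// ltr_pMr// ltr1n.
Qed.

Lemma within_continuousP A (f : R -> R) :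
  (forall x, A x -> forall e : R, 0 < e -> exists2 d : R, 0 < d & forall y,
    A y -> `|y - x| < d -> `|f y - f x| < e) ->
  {within A, continuous f}.
Proof.
move=> fc; apply/subspace_continuousP => x Ax.
apply/cvgrPdist_lt => e e0; have [d d0 fd] := fc _ Ax _ e0.
exists d => //= y xyd Ay.
by rewrite distrC; apply: fd => //; rewrite distrC.
Qed.

End one_sided_derivatives.

(** * Real powers *)

Section power_inequalities.
Context {R : realType}.
Implicit Types (a b alpha : R).

Lemma powR_subadditive a b alpha : 0 < alpha <= 1 -> 0 <= a -> 0 <= b ->
  (a + b) `^ alpha <= a `^ alpha + b `^ alpha.
Proof.
move=> /andP[al0 al1] a0 b0.
have [->|an0] := eqVneq a 0; first by rewrite add0r lerDr powR_ge0.
have [->|bn0] := eqVneq b 0; first by rewrite addr0 lerDl powR_ge0.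
have {a0 an0}a0 : 0 < a by rewrite lt_def an0.
have {b0 bn0}b0 : 0 < b by rewrite lt_def bn0.
have s0 : 0 < a + b by rewrite addr_gt0.
have part x : 0 < x -> x <= a + b ->
    x / (a + b) * (a + b) `^ alpha <= x `^ alpha.
  move=> x0 xs; have -> : x `^ alpha = (x / (a + b)) `^ alpha * (a + b) `^ alpha.
    by rewrite -powRM ?divfK ?lt0r_neq0 ?divr_ge0// ltW.
  rewrite ler_wpM2r ?powR_ge0// ger1_powR//.
  by rewrite divr_gt0//= ler_pdivrMr ?mul1r.
have := lerD (part _ a0 _) (part _ b0 _).
by rewrite -mulrDl -mulrDl mulfV ?lt0r_neq0// mul1r; apply; rewrite ?lerDl ?lerDr ltW.
Qed.

Lemma powR_dist_le a b alpha : 0 < alpha <= 1 -> 0 <= a -> 0 <= b ->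
  `|a `^ alpha - b `^ alpha| <= `|a - b| `^ alpha.
Proof.
move=> al; have /andP[al0 al1] := al; wlog ba : a b / b <= a => [H|] a0 b0.
  by have [/H|/ltW/H] := leP b a; [exact|rewrite distrC [`|a - b|]distrC; exact].
have ab0 : 0 <= a - b by rewrite subr_ge0.
rewrite !ger0_norm//; last first.
  by rewrite subr_ge0 ge0_ler_powR ?nnegrE// ltW.
rewrite lerBlDr -{1}(subrK b a); exact: powR_subadditive.
Qed.

Lemma powR_lt_root (t e a : R) : 0 < a -> 0 <= t -> 0 < e -> t < e `^ a^-1 ->
  t `^ a < e.
Proof.
move=> a0 t0 e0 te; have eE : e = (e `^ a^-1) `^ a.
  by rewrite -powRrM mulVf ?gt_eqF// powRr1// ltW.
by rewrite [ltRHS]eE gt0_ltr_powR// nnegrE powR_ge0.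
Qed.

(** The graph of a power with exponent in (0, 1) lies below its tangents. *)
Lemma powR_concave a b alpha : 0 < alpha < 1 -> 0 <= b -> 0 < a ->
  alpha * a `^ (alpha - 1) * (a - b) <= a `^ alpha - b `^ alpha.
Proof.
move=> /andP[al0 al1] b0 a0.
have an0 := lt0r_neq0 a0.
have r0 : 0 <= b / a by rewrite divr_ge0// ltW.
have bern : (b / a) `^ alpha <= alpha * (b / a) + (1 - alpha).
  have be0 : 0 < 1 - alpha by rewrite subr_gt0.
  have := @conjugate_powR R ((b / a) `^ alpha) 1 alpha^-1 (1 - alpha)^-1.
  rewrite !invrK powR_ge0 ler01 !invr_gt0 al0 be0 addrC subrK => /(_ isT isT isT isT erefl).
  rewrite mulr1 powR1 mul1r -powRrM mulfV ?lt0r_neq0// powRr1//.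
  by rewrite [_ * alpha]mulrC.
have -> : a `^ (alpha - 1) = a `^ alpha / a.
  by rewrite powRB ?an0 ?implybT// powRr1// ltW.
have -> : b `^ alpha = (b / a) `^ alpha * a `^ alpha.
  by rewrite -powRM// ?divfK// ltW.
have p0 : 0 <= a `^ alpha by exact: powR_ge0.
have -> : alpha * (a `^ alpha / a) * (a - b) =
    a `^ alpha - (alpha * (b / a) + (1 - alpha)) * a `^ alpha by field.
by rewrite lerD2l lerN2 ler_wpM2r.
Qed.

(** The inverse of a power with exponent in (0, 1) is Lipschitz on (0, 1]. *)
Lemma powR_inv_lipschitz (alpha s t : R) :
  0 < alpha < 1 -> 0 < s <= 1 -> 0 < t <= 1 ->
  `|s `^ alpha^-1 - t `^ alpha^-1| <= alpha^-1 * `|s - t|.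
Proof.
move=> al; have /andP[al0 al1] := al.
wlog st : s t / t <= s => [H|] s01 t01.
  by have [/H|/ltW/H] := leP t s; [exact|rewrite distrC [`|s - t|]distrC; exact].
have [/andP[s0 s1] /andP[t0 t1]] := (s01, t01).
have ai0 : 0 < alpha^-1 by rewrite invr_gt0.
have pst : t `^ alpha^-1 <= s `^ alpha^-1.
  by apply: ge0_ler_powR => //; rewrite ?nnegrE ltW.
rewrite (ger0_norm (_ : 0 <= s - t)) ?subr_ge0// ger0_norm ?subr_ge0//.
have K (x : R) : 0 < x -> (x `^ alpha^-1) `^ alpha = x.
  by move=> x0; rewrite -powRrM mulVf ?gt_eqF// powRr1// ltW.
have := @powR_concave (s `^ alpha^-1) (t `^ alpha^-1) _ al (powR_ge0 _ _)
  (powR_gt0 _ s0).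
rewrite !K// => H; rewrite ler_pdivlMl//; apply: le_trans H.
rewrite -mulrA ler_pM2l// ler_peMl//.
  by rewrite subr_ge0.
rewrite -powRrM -[leLHS](powRr0 s); apply: ger_powR; first by rewrite s0.
by rewrite ler_pdivrMl// mulr0 subr_le0 ltW.
Qed.

Lemma expn_unbounded (tau B : R) : 1 < tau -> exists n, B < tau ^+ n.
Proof.
move=> tau1; have t0 : 0 < tau - 1 by rewrite subr_gt0.
have bern n : n%:R * (tau - 1) + 1 <= tau ^+ n.
  elim: n => [|n IH]; first by rewrite mul0r add0r expr0.
  have n0 : 0 <= n%:R * (tau - 1) * (tau - 1) by rewrite !mulr_ge0// ltW.
  have := ler_wpM2l (ltW (lt_trans ltr01 tau1)) IH.
  rewrite -exprS -natr1 => H; apply: le_trans H; nra.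
exists (Num.bound (`|B| / (tau - 1))); apply: lt_le_trans (bern _).
rewrite ltr_wpDr// -ltr_pdivrMr//.
apply: (@le_lt_trans _ _ (`|B| / (tau - 1))).
  by rewrite ler_wpM2r ?ler_norm// invr_ge0 ltW.
by rewrite archi_boundP// divr_ge0// ltW.
Qed.

End power_inequalities.

(** * The Hölder norm *)

Section C1holder_norm.
Context {R : realType}.
Implicit Types (A S : set R) (f g phi psi : R -> R) (rho M : R).

(** No condition on [S]: the supremum is 0 by default. *)
Lemma sup_nonneg S : (forall x, S x -> 0 <= x) -> 0 <= sup S.
Proof.
move=> S0; have [|/sup_out -> //] := pselect (has_sup S).
move=> [[x Sx] ubS]; exact: le_trans (S0 _ Sx) (ub_le_sup ubS Sx).
Qed.

(** No condition that [S] be nonempty: the supremum of the empty set is 0. *)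
Lemma sup_le_nonneg S M : 0 <= M -> (forall x, S x -> x <= M) -> sup S <= M.
Proof.
move=> M0 SM; have [S0|/set0P/negP] := pselect (S !=set0).
  exact: ge_sup.
by rewrite negbK => /eqP ->; rewrite sup0.
Qed.

Lemma C1holder_norm_ge0 rho A phi : 0 <= C1holder_norm rho A phi.
Proof.
rewrite !addr_ge0//; apply: sup_nonneg => _ [? _ <-] //.
Qed.

Lemma C1holder_norm_sup rho A phi x : A x ->
  (exists M, forall y, A y -> `|phi y| <= M) -> `|phi x| <= C1holder_norm rho A phi.
Proof.
move=> Ax [M phiM]; rewrite /C1holder_norm -addrA.
rewrite -[leLHS]addr0 lerD//.
  by apply: ub_le_sup; [exists M => _ [y Ay <-]; exact: phiM|exists x].
rewrite addr_ge0//; apply: sup_nonneg => _ [? _ <-] //.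
Qed.

Lemma C1holder_norm_deriv rho A phi x : A x ->
  (exists M, forall y, A y -> `|deriv_on A phi y| <= M) ->
  `|deriv_on A phi x| <= C1holder_norm rho A phi.
Proof.
move=> Ax [M phiM]; rewrite /C1holder_norm addrAC.
rewrite -[leLHS]add0r lerD//; last first.
  by apply: ub_le_sup; [exists M => _ [y Ay <-]; exact: phiM|exists x].
rewrite addr_ge0//; apply: sup_nonneg => _ [? _ <-] //.
Qed.

Lemma C1holder_norm_le rho A phi M0 M1 M2 : 0 <= M0 -> 0 <= M1 -> 0 <= M2 ->
  (forall x, A x -> `|phi x| <= M0) ->
  (forall x, A x -> `|deriv_on A phi x| <= M1) ->
  (forall x y, A x -> A y ->
    `|deriv_on A phi x - deriv_on A phi y| <= M2 * `|x - y| `^ rho) ->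
  C1holder_norm rho A phi <= M0 + M1 + M2.
Proof.
move=> M00 M10 M20 H0 H1 H2; rewrite !lerD//; apply: sup_le_nonneg => //.
- by move=> _ [x Ax <-]; exact: H0.
- by move=> _ [x Ax <-]; exact: H1.
- move=> _ [[x y] /= [Ax Ay xy] <-].
  by rewrite ler_pdivrMr ?powR_gt0 ?normr_gt0 ?subr_eq0//; exact: H2.
Qed.

Lemma C1holder_deriv_bounded rho (a b : R) phi : 0 < rho -> a < b ->
  C1holder rho `[a, b]%classic phi ->
  exists2 M, 0 <= M & forall x, a <= x <= b -> `|deriv_on `[a, b] phi x| <= M.
Proof.
move=> rho0 ab [_ [K phiK]].
have aba : `[a, b]%classic a by rewrite /= in_itv/= lexx ltW.
exists (`|K| * (b - a) `^ rho + `|deriv_on `[a, b] phi a|) => [|x /andP[ax xb]].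
  by rewrite addr_ge0// mulr_ge0// powR_ge0.
have abx : `[a, b]%classic x by rewrite /= in_itv/= ax.
rewrite -lerBlDr (le_trans (lerB_dist _ _))//.
rewrite (le_trans (phiK _ _ abx aba))// (@le_trans _ _ (`|K| * `|x - a| `^ rho))//.
  by rewrite ler_wpM2r ?powR_ge0 ?ler_norm.
have xa0 : 0 <= x - a by rewrite subr_ge0.
rewrite (ger0_norm xa0) ler_wpM2l//; apply: ge0_ler_powR.
- exact: ltW.
- by rewrite nnegrE.
- by rewrite nnegrE subr_ge0 ltW.
- by rewrite lerB.
Qed.

Lemma C1holder_bounded rho (a b : R) phi : 0 < rho -> a < b ->
  C1holder rho `[a, b]%classic phi ->
  exists2 M, 0 <= M & forall x, a <= x <= b -> `|phi x| <= M.
Proof.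
move=> rho0 ab [dphi _].
have : {within `[a, b], continuous phi}.
  apply: within_continuousP => x abx e e0.
  by have [d d0 dd] := derivable_on_continuous (dphi _ abx) e0; exists d.
move=> phic; have := continuous_compact phic (@segment_compact _ a b).
move=> /compact_bounded[M [Mr phiM]]; exists (`|M| + 1); first by rewrite addr_ge0.
move=> x abx; apply: (phiM (`|M| + 1)).
  by rewrite (le_lt_trans (ler_norm M))// ltrDl.
by exists x => //=; rewrite in_itv.
Qed.

(** The norm of a difference controls values and derivatives pointwise. *)
Lemma C1holder_normB rho (a b : R) phi psi x : 0 < rho -> a < b ->
  C1holder rho `[a, b]%classic phi -> C1holder rho `[a, b]%classic psi ->
  a <= x <= b ->
  `|phi x - psi x| <= C1holder_norm rho `[a, b] (phi \- psi) /\
  `|deriv_on `[a, b] phi x - deriv_on `[a, b] psi x|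
    <= C1holder_norm rho `[a, b] (phi \- psi).
Proof.
move=> rho0 ab rphi rpsi abx; have [dphi _] := rphi; have [dpsi _] := rpsi.
have AE y : `[a, b]%classic y -> a <= y <= b by rewrite /= in_itv.
have Ax : `[a, b]%classic x by rewrite /= in_itv.
have dB y : `[a, b]%classic y -> deriv_on `[a, b] (phi \- psi) y =
    deriv_on `[a, b] phi y - deriv_on `[a, b] psi y.
  move=> Ay; apply: deriv_onB; [|exact: dphi|exact: dpsi].
  exact/limit_point_itv/AE.
have [M0 M00 HM0] := C1holder_bounded rho0 ab rphi.
have [N0 N00 HN0] := C1holder_bounded rho0 ab rpsi.
have [M1 M10 HM1] := C1holder_deriv_bounded rho0 ab rphi.
have [N1 N10 HN1] := C1holder_deriv_bounded rho0 ab rpsi.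
split.
  apply: (@C1holder_norm_sup rho _ (phi \- psi)) => //.
  exists (M0 + N0) => y /AE aby /=.
  by rewrite (le_trans (ler_normB _ _))// lerD ?HM0 ?HN0.
rewrite -dB//; apply: C1holder_norm_deriv => //.
exists (M1 + N1) => y Ay; rewrite dB//; move/AE : Ay => Ay.
by rewrite (le_trans (ler_normB _ _))// lerD ?HM1 ?HN1.
Qed.

End C1holder_norm.

(** * The branches of a Lorenz map *)

(** The map [f], completed at the singularity by its left limit: an everywhere
    defined self-map of the unit interval, continuous up to [c] on the left, which
    sends [c] to the singular value [f(c-)]. *)
Definition left_ext {R : realType} (c : R) (f : R -> R) (x : R) : R :=
  if x == c then left_value c f else f x.

Section lorenz_branches.
Context {R : realType} {rho c alpha beta : R}.
Local Notation L := (lorenz_map rho c alpha beta).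
Local Notation dom := (lorenz_dom c).
Local Notation lphi f := (left_phi rho c alpha f).
Local Notation rphi f := (right_phi rho c beta f).
Implicit Types (f g h : L) (x y z e : R).

Lemma lorenz_params (f : L) :
  [/\ 0 < rho < 1, 0 < alpha < 1, 0 < beta < 1 & 0 < c < 1].
Proof.
have [? ? ?] := lorenz_exponents (lorenz_mapP f).
by split => //; exact: lorenz_sing (lorenz_expands (lorenz_mapP f)).
Qed.

Lemma lorenz_domP x : dom x <-> 0 <= x <= 1 /\ x != c.
Proof.
rewrite /lorenz_dom /=; split=> [[/= + xc]|[x01 /eqP xc]].
  by rewrite in_itv /= => ->; split => //; exact/eqP.
by split => //=; rewrite in_itv.
Qed.

Lemma limit_point_dom (f : L) x : dom x -> limit_point_of dom x.
Proof.
have [_ _ _ /andP[c0 c1]] := lorenz_params f.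
move=> /lorenz_domP[/andP[x0 x1] xc] d d0; have [xltc|cltx] := ltP x c.
  have acc : limit_point_of `[0, (x + c) / 2]%classic x.
    by apply: limit_point_itv; lra.
  have [y [+ yx yd]] := acc _ d0; rewrite /= in_itv/= => /andP[y0 yc].
  by exists y; split => //; apply/lorenz_domP; split; [lra|rewrite lt_eqF//; lra].
have {}cltx : c < x by rewrite lt_def xc.
have acc : limit_point_of `[(x + c) / 2, 1]%classic x.
  by apply: limit_point_itv; lra.
have [y [+ yx yd]] := acc _ d0; rewrite /= in_itv/= => /andP[y0 yc].
by exists y; split => //; apply/lorenz_domP; split; [lra|rewrite gt_eqF//; lra].
Qed.

Lemma left_C1 f : C1holder rho `[0, c]%classic (lphi f).
Proof. by have [_ [] ] := left_branch_phi f. Qed.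

Lemma right_C1 f : C1holder rho `[c, 1]%classic (rphi f).
Proof. by have [_ [] ] := right_branch_phi f. Qed.

Lemma left_phi_ge0 f x : 0 <= x <= c -> 0 <= lphi f x.
Proof.
have [_ [_ [+ _ _] _] _ _ _] := left_branch_phi f.
by move=> /(_ x) + xc => /(_ xc); rewrite /= in_itv /= => /andP[].
Qed.

Lemma left_phi_gt0 f x : 0 <= x < c -> 0 < lphi f x.
Proof.
move=> /andP[x0 xc].
have x0c : 0 <= x <= c by rewrite x0 ltW.
rewrite lt_def left_phi_ge0 // andbT; apply/eqP => phix.
have [_ [_ [_ inj _] _] phic _ _] := left_branch_phi f.
have : x = c; last by move=> xE; rewrite xE ltxx in xc.
by apply: inj; rewrite ?inE/= ?in_itv/= ?phix ?phic// lexx (le_trans x0) // ltW.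
Qed.

Lemma right_phi_ge0 f x : c <= x <= 1 -> 0 <= rphi f x.
Proof.
have [_ [_ [+ _ _] _] _ _ _] := right_branch_phi f.
by move=> /(_ x) + xc => /(_ xc); rewrite /= in_itv /= => /andP[].
Qed.

Lemma left_extE f x : x != c -> left_ext c f x = f x.
Proof. by rewrite /left_ext => /negbTE ->. Qed.

Lemma left_ext_c f : left_ext c f c = left_value c f.
Proof. by rewrite /left_ext eqxx. Qed.

Lemma left_ext_left f x : 0 <= x <= c ->
  left_ext c f x = left_value c f - lphi f x `^ alpha.
Proof.
have [_ /andP[al0 _] _ /andP[c0 c1]] := lorenz_params f.
move=> /andP[x0]; have [_ _ phic _ fE] := left_branch_phi f.
rewrite le_eqVlt => /predU1P[->|xc].
  by rewrite left_ext_c phic powR0 ?subr0// gt_eqF.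
by rewrite left_extE ?lt_eqF// fE ?x0.
Qed.

Lemma left_ext_right f x : c < x <= 1 ->
  left_ext c f x = right_value c f + rphi f x `^ beta.
Proof.
move=> cx; have [_ _ _ _ fE] := right_branch_phi f.
by case/andP: (cx) => ltcx _; rewrite left_extE ?gt_eqF// fE// subKr.
Qed.

Lemma left_value_itv f : 0 <= left_value c f <= 1.
Proof. by have [] := left_branch_phi f. Qed.

Lemma left_ext_itv f x : 0 <= x <= 1 -> 0 <= left_ext c f x <= 1.
Proof.
move=> x01; have [->|xc] := eqVneq x c; first by rewrite left_ext_c left_value_itv.
rewrite left_extE//; apply: (lorenz_range (lorenz_expands (lorenz_mapP f))).
exact/lorenz_domP.
Qed.

(** The completed map is continuous on the closed left interval and on the
    right interval deprived of [c]; the condition [(y <= c) = (x <= c)] says that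
    [x] and [y] lie in the same one. *)
Lemma left_ext_continuous f x : 0 <= x <= 1 -> forall e : R, 0 < e ->
  exists2 d : R, 0 < d & forall y, 0 <= y <= 1 -> (y <= c) = (x <= c) ->
    `|y - x| < d -> `|left_ext c f y - left_ext c f x| < e.
Proof.
have [_ al be /andP[c0 c1]] := lorenz_params f.
have [/andP[al0 /ltW al1] /andP[be0 /ltW be1]] := (al, be).
move=> /andP[x0 x1] e e0; have [xc|cx] := leP x c.
  have xI : 0 <= x <= c by rewrite x0.
  have [dphi _] := left_C1 f.
  have e'0 : 0 < e `^ alpha^-1 by rewrite powR_gt0.
  have dx : derivable_on `[0, c] (lphi f) x by apply: dphi; rewrite /= in_itv.
  have [d d0 dd] := derivable_on_continuous dx e'0.
  exists d => // y /andP[y0 y1] yc yxd.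
  have yI : 0 <= y <= c by rewrite y0.
  rewrite !left_ext_left// [X in `|X|](_ : _ =
    - (lphi f y `^ alpha - lphi f x `^ alpha)); last by ring.
  rewrite normrN.
  rewrite (le_lt_trans (powR_dist_le _ _ _)) ?al0 ?left_phi_ge0//.
  by apply: powR_lt_root => //; apply: dd => //=; rewrite in_itv.
have xI : c <= x <= 1 by rewrite x1 ltW.
have [dphi _] := right_C1 f.
have e'0 : 0 < e `^ beta^-1 by rewrite powR_gt0.
have dx : derivable_on `[c, 1] (rphi f) x by apply: dphi; rewrite /= in_itv.
have [d d0 dd] := derivable_on_continuous dx e'0.
exists d => // y /andP[y0 y1] /negbT; rewrite -ltNge => cy yxd.
have yI : c <= y <= 1 by rewrite y1 ltW.
rewrite !left_ext_right ?cy ?cx// opprD addrACA subrr add0r.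
rewrite (le_lt_trans (powR_dist_le _ _ _)) ?be0 ?right_phi_ge0//.
by apply: powR_lt_root => //; apply: dd => //=; rewrite in_itv.
Qed.

Lemma lorenz_derivable f x : dom x -> derivable_on dom f x.
Proof. by move: x; have [] := lorenz_C1 (lorenz_expands (lorenz_mapP f)). Qed.

Let sum4_lt (p q r s e : R) : 0 <= p -> 0 <= q -> 0 <= r -> 0 <= s ->
  p + q + r + s < e -> [/\ p < e, q < e, r < e & s < e].
Proof. by move=> *; split; lra. Qed.

Lemma lorenz_dist_left f g e x : lorenz_dist f g < e -> 0 <= x <= c ->
  [/\ `|left_value c f - left_value c g| < e, `|lphi f x - lphi g x| < e &
    `|deriv_on `[0, c] (lphi f) x - deriv_on `[0, c] (lphi g) x| < e].
Proof.
have [/andP[rho0 _] _ _ /andP[c0 c1]] := lorenz_params f.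
move=> fge xI; have [H0 H1] := C1holder_normB rho0 c0 (left_C1 f) (left_C1 g) xI.
have Nl := C1holder_norm_ge0 rho `[0, c]%classic (lphi f \- lphi g).
have Nr := C1holder_norm_ge0 rho `[c, 1]%classic (rphi f \- rphi g).
have [d1 d2 dl dr] := sum4_lt (normr_ge0 _) (normr_ge0 _) Nl Nr fge.
by split => //; apply: le_lt_trans dl.
Qed.

Lemma lorenz_dist_right f g e x : lorenz_dist f g < e -> c <= x <= 1 ->
  `|right_value c f - right_value c g| < e /\ `|rphi f x - rphi g x| < e.
Proof.
have [/andP[rho0 _] _ _ /andP[c0 c1]] := lorenz_params f.
move=> fge xI; have [H0 H1] := C1holder_normB rho0 c1 (right_C1 f) (right_C1 g) xI.
have Nl := C1holder_norm_ge0 rho `[0, c]%classic (lphi f \- lphi g).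
have Nr := C1holder_norm_ge0 rho `[c, 1]%classic (rphi f \- rphi g).
have [d1 d2 dl dr] := sum4_lt (normr_ge0 _) (normr_ge0 _) Nl Nr fge.
by split => //; apply: le_lt_trans dr.
Qed.

(** The metric controls uniform distance; only a modulus of continuity is
    available, because the powers are not Lipschitz at the singularity. *)
Lemma left_ext_close (al : 0 < alpha < 1) (be : 0 < beta < 1) e : 0 < e ->
  exists2 d : R, 0 < d & forall f g, lorenz_dist f g < d ->
    forall x, 0 <= x <= 1 -> `|left_ext c f x - left_ext c g x| < e.
Proof.
have [/andP[al0 /ltW al1] /andP[be0 /ltW be1]] := (al, be).
move=> e0; have e20 : 0 < e / 2 by rewrite divr_gt0.
exists (Num.min (e / 2) (Num.min ((e / 2) `^ alpha^-1) ((e / 2) `^ beta^-1))).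
  by rewrite !lt_min e20 !powR_gt0.
move=> f g; rewrite !lt_min => /and3P[fg1 fg2 fg3] x /andP[x0 x1].
have [xc|cx] := leP x c.
  have xI : 0 <= x <= c by rewrite x0.
  have [H1 _ _] := lorenz_dist_left fg1 xI.
  have [_ H2 _] := lorenz_dist_left fg2 xI.
  rewrite !left_ext_left// [X in `|X|](_ : _ = left_value c f - left_value c g -
    (lphi f x `^ alpha - lphi g x `^ alpha)); last by ring.
  rewrite (le_lt_trans (ler_normB _ _))// [e]splitr ltrD//.
  rewrite (le_lt_trans (powR_dist_le _ _ _)) ?al0 ?left_phi_ge0//.
  exact: powR_lt_root.
have xI : c <= x <= 1 by rewrite x1 ltW.
have [H1 _] := lorenz_dist_right fg1 xI.
have [_ H2] := lorenz_dist_right fg3 xI.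
rewrite !left_ext_right ?cx// opprD addrACA.
rewrite (le_lt_trans (ler_normD _ _))// [e]splitr ltrD//.
rewrite (le_lt_trans (powR_dist_le _ _ _)) ?be0 ?right_phi_ge0//.
exact: powR_lt_root.
Qed.

(** The map extended to [c] from the left is differentiable off the
    singularity, so the mean value theorem holds up to [c] on the left. *)
Lemma left_ext_MVT f x y : 0 <= x -> x < y -> y <= 1 -> (x <= c) = (y <= c) ->
  exists2 z, x < z < y & z != c /\
    left_ext c f y - left_ext c f x = deriv_on dom f z * (y - x).
Proof.
move=> x0 xy y1 xyc.
have zc z : x < z < y -> z != c.
  move=> /andP[xz zy]; apply/eqP => zc; move: xyc.
  by rewrite -zc (ltW xz) leNgt zy.
have isd z : z \in `]x, y[ -> is_derive z 1 (left_ext c f) (deriv_on dom f z).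
  rewrite in_itv/= => /andP[xz zy].
  have zI : x < z < y by rewrite xz.
  have r0 : 0 < Num.min (z - x) (y - z) by rewrite lt_min !subr_gt0 xz.
  have near_z t : `|t - z| < Num.min (z - x) (y - z) -> dom t.
    rewrite lt_min => /andP[]; rewrite !ltr_norml => /andP[t1 _] /andP[_ t2].
    by apply/lorenz_domP; split; [lra|apply: zc; lra].
  have domz : dom z by apply: near_z; rewrite subrr normr0.
  have [|df dE] := @deriv_on_germ R dom dom (left_ext c f) f 1 z domz
    (limit_point_dom f domz) _ (@lorenz_derivable f _ domz).
    exists 1 => // t _ domt; split => //; rewrite mul1r left_extE//.
    by have /lorenz_domP[] := domt.
  rewrite mul1r in dE; rewrite -dE.
  exact: (derivable_on_is_derive r0).
have cont : {within `[x, y], continuous (left_ext c f)}.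
  apply: within_continuousP => z /=; rewrite in_itv/= => /andP[xz zy] e e0.
  have z01 : 0 <= z <= 1 by rewrite (le_trans x0)//= (le_trans zy).
  have [d d0 dd] := left_ext_continuous f z01 e0.
  exists d => // t; rewrite in_itv/= => /andP[xt ty]; apply: dd.
    by rewrite (le_trans x0)//= (le_trans ty).
  have side u : x <= u -> u <= y -> (u <= c) = (y <= c).
    move=> xu uy; apply/idP/idP => [uc|yc]; last exact: le_trans yc.
    by rewrite -xyc (le_trans xu).
  by rewrite !side.
have [z] := MVT xy isd cont; rewrite in_itv/= => zI fE.
by exists z => //; split => //; exact: zc.
Qed.

(** Since powers with exponent below 1 are concave, the derivative of the left
    branch is bounded below in terms of [lphi f] near the singularity. *)
Lemma left_deriv_ge f x : 0 < x < c ->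
  alpha * lphi f x `^ (alpha - 1) * - deriv_on `[0, c] (lphi f) x
    <= deriv_on dom f x.
Proof.
have [_ al _ /andP[c0 c1]] := lorenz_params f; have /andP[al0 al1] := al.
move=> /andP[x0 xc]; have xI : `[0, c]%classic x by rewrite /= in_itv/= !ltW.
have domx : dom x by apply/lorenz_domP; rewrite lt_eqF//; split => //; lra.
have [+ _] := left_C1 f => /(_ x xI) /deriv_on_cvg/slope_cvgP.
set l := deriv_on _ _ _ => slope.
have phi0 : 0 < lphi f x by apply: left_phi_gt0; rewrite ltW.
set C := alpha * _; have C0 : 0 < C by rewrite mulr_gt0// powR_gt0.
rewrite -ler_pdivlMl//; apply/ler_addgt0Pr => e e0.
rewrite -lerBlDr; rewrite ler_pdivlMl//.
apply: deriv_on_ge (@lorenz_derivable f _ domx) _ => d d0.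
have [d' d'0 dd'] := slope _ e0.
have m0 : 0 < Num.min (d / 2) (Num.min (d' / 2) ((c - x) / 2)).
  by rewrite !lt_min !divr_gt0// subr_gt0.
set m := Num.min _ _ in m0.
have /and3P[md md' mc] : [&& m <= d / 2, m <= d' / 2 & m <= (c - x) / 2].
  by rewrite -!le_min.
have mx : x + m - x = m by ring.
exists (x + m); rewrite mx; split.
- by apply/lorenz_domP; split; [lra|rewrite lt_eqF//; lra].
- by rewrite gt_eqF// ltrDl.
- by rewrite gtr0_norm//; lra.
have := dd' (x + m); rewrite mx gtr0_norm// => /(_ _ _ _).
have xmI : 0 <= x + m <= c by lra.
have -> : x + m != x by rewrite gt_eqF// ltrDl.
rewrite /= in_itv/= xmI => /(_ isT isT); have -> : (m < d') = true by lra.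
move=> /(_ isT); rewrite ltr_norml => /andP[_ sl].
have [_ _ _ _ fE] := left_branch_phi f.
rewrite !fE; [|lra|lra].
rewrite [X in _ <= X / _](_ : _ =
  lphi f x `^ alpha - lphi f (x + m) `^ alpha); last by ring.
rewrite ler_pdivlMr//.
apply: le_trans (powR_concave al (left_phi_ge0 f xmI) phi0).
rewrite -/C -mulrA ler_pM2l//.
move: sl; rewrite ltrBlDr ltr_pdivrMr// => sl.
by move: sl; rewrite mulrBl mulNr mulrDl; lra.
Qed.

(** The derivative of the diffeomorphism [lphi f] cannot vanish at [c], since its
    inverse has a finite derivative at 0. *)
Lemma left_phi_deriv_c f : deriv_on `[0, c] (lphi f) c < 0.
Proof.
have [_ _ _ /andP[c0 c1]] := lorenz_params f.
have [_ [[dphi _] [surj inj _] [psi psiK [dpsi _]]] phic _ _] := left_branch_phi f.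
have cI : `[0, c]%classic c by rewrite /= in_itv/= lexx ltW.
have phicI := surj _ cI.
have /slope_cvgP/(_ _ ltr01)[d d0 dd] := deriv_on_cvg (dpsi _ phicI).
rewrite phic in dd; set l := deriv_on _ psi _ in dd.
have [d' d'0 dd'] := derivable_on_continuous (dphi _ cI) d0.
rewrite phic in dd'.
have l0 : 0 < `|l| + 1 by rewrite ltr_wpDl.
have il0 : 0 < (`|l| + 1)^-1 by rewrite invr_gt0.
suff : - deriv_on `[0, c] (lphi f) c >= (`|l| + 1)^-1 by lra.
have [+ +] : derivable_on `[0, c] (fun y => -1 * lphi f y) c /\
    deriv_on `[0, c] (fun y => -1 * lphi f y) c = -1 * deriv_on `[0, c] (lphi f) c.
  apply: (@deriv_on_germ R _ `[0, c]%classic) => //; last exact: dphi.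
    by apply: limit_point_itv => //; rewrite lexx ltW.
  by exists 1.
rewrite mulN1r => dn <-; apply: (deriv_on_ge dn) => e e0.
have m0 : 0 < Num.min (e / 2) (Num.min (d' / 2) (c / 2)).
  by rewrite !lt_min !divr_gt0.
set m := Num.min _ _ in m0.
have /and3P[me md' mc] : [&& m <= e / 2, m <= d' / 2 & m <= c / 2].
  by rewrite -!le_min.
have mE : c - m - c = - m by ring.
have yI : 0 <= c - m <= c by lra.
have yA : `[0, c]%classic (c - m) by rewrite /= in_itv.
exists (c - m); rewrite mE; split => //.
- by rewrite lt_eqF// gtrBl.
- by rewrite normrN gtr0_norm//; lra.
have phi0 : 0 < lphi f (c - m) by apply: left_phi_gt0; lra.
have := dd' _ yA; rewrite mE subr0 normrN (gtr0_norm m0).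
have -> : m < d' by lra.
move=> /(_ isT) phid.
have := dd _ (surj _ yA); rewrite subr0 gt_eqF// => /(_ isT phid).
rewrite psiK// -[X in psi X]phic psiK// mE => sl.
have {}sl : m / lphi f (c - m) <= `|l| + 1.
  have : `|- m / lphi f (c - m)| <= `|l| + 1.
    rewrite -[X in `|X|](subrK l) addrC (le_trans (ler_normD _ _))//.
    by rewrite lerD2l ltW.
  by rewrite mulNr normrN gtr0_norm// divr_gt0.
rewrite /= phic mulr0 subr0 mulN1r mulNr invrN mulrN opprK.
rewrite -[leRHS]invrK lef_pV2 ?posrE ?invr_gt0 ?divr_gt0//.
by rewrite invf_div.
Qed.

Lemma left_phi_deriv_near f : exists m : R, exists2 d : R, 0 < m & 0 < d /\
  forall x, c - d <= x <= c -> 0 <= x /\ deriv_on `[0, c] (lphi f) x <= - m.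
Proof.
have [/andP[rho0 _] _ _ /andP[c0 c1]] := lorenz_params f.
have l0 := left_phi_deriv_c f; set l := deriv_on _ _ _ in l0.
have [_ [K phiK]] := left_C1 f.
have K0 : 0 < `|K| + 1 by rewrite ltr_wpDl.
have e0 : 0 < - l / 2 / (`|K| + 1) by rewrite !divr_gt0// oppr_gt0.
exists (- l / 2), (Num.min c ((- l / 2 / (`|K| + 1)) `^ rho^-1 / 2)).
  by rewrite divr_gt0// oppr_gt0.
split; first by rewrite lt_min c0 divr_gt0// powR_gt0.
move=> x /andP[xc1 xc].
have /andP[d1 d2] : (c - x <= c) && (c - x <= (- l / 2 / (`|K| + 1)) `^ rho^-1 / 2).
  by rewrite -le_min; lra.
have x0 : 0 <= x by lra.
split=> //.
have cI : `[0, c]%classic c by rewrite /= in_itv/= lexx ltW.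
have xI : `[0, c]%classic x by rewrite /= in_itv/= x0.
have := phiK _ _ xI cI; rewrite -/l.
rewrite [`|x - c|]distrC (ger0_norm (_ : 0 <= c - x)) ?subr_ge0// => H.
have pe : (c - x) `^ rho < - l / 2 / (`|K| + 1).
  apply: powR_lt_root => //; first by rewrite subr_ge0.
  rewrite (le_lt_trans d2)// ltr_pdivrMr// ltr_pMr ?powR_gt0//; lra.
have : K * (c - x) `^ rho <= - l / 2.
  apply: (@le_trans _ _ ((`|K| + 1) * (c - x) `^ rho)).
    by rewrite ler_wpM2r ?powR_ge0// (le_trans (ler_norm K))// lerDl.
  by rewrite mulrC -ler_pdivlMr// ltW.
move: H; rewrite ler_norml; lra.
Qed.

End lorenz_branches.

(** * Scaling the left branch *)

Section scaling.
Context {R : realType}.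
Implicit Types (A : set R) (phi psi : R -> R) (rho k D : R).

Lemma C1holder_scale rho A k phi : (forall x, A x -> limit_point_of A x) ->
  C1holder rho A phi -> C1holder rho A (fun x => k * phi x) /\
  forall x, A x -> deriv_on A (fun y => k * phi y) x = k * deriv_on A phi x.
Proof.
move=> acc [dphi [K phiK]].
have E x : A x -> derivable_on A (fun y => k * phi y) x /\
    deriv_on A (fun y => k * phi y) x = k * deriv_on A phi x.
  move=> Ax; apply: (@deriv_on_germ _ A A) => //; [exact: acc| |exact: dphi].
  by exists 1.
split; last by move=> x /E[].
split; first by move=> x /E[].
exists (`|k| * K) => x y Ax Ay.
have [_ ->] := E _ Ax; have [_ ->] := E _ Ay.
by rewrite -mulrBr normrM -mulrA ler_wpM2l// phiK.
Qed.

Lemma C1holder_scale_dom rho k D psi : 0 < k -> 0 < D ->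
  C1holder rho `[0, D]%classic psi ->
  C1holder rho `[0, k * D]%classic (fun u => psi (u / k)).
Proof.
move=> k0 D0 [dpsi [K psiK]]; have kn0 := lt0r_neq0 k0.
have kD0 : 0 < k * D by rewrite mulr_gt0.
have dom u : `[0, k * D]%classic u -> `[0, D]%classic (u / k).
  rewrite /= !in_itv/= => /andP[u0 uD].
  by rewrite divr_ge0 ?(ltW k0)//= ler_pdivrMr// mulrC.
have E u : `[0, k * D]%classic u ->
    derivable_on `[0, k * D] (fun u => psi (u / k)) u /\
    deriv_on `[0, k * D] (fun u => psi (u / k)) u =
    k^-1 * deriv_on `[0, D] psi (u / k).
  move=> uA; apply: cvg_deriv_on.
    by apply: limit_point_itv => //; move: uA; rewrite /= in_itv.
  have /deriv_on_cvg/slope_cvgP sl := dpsi _ (dom _ uA).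
  apply/slope_cvgP => e e0; have [d d0 dd] := sl _ (mulr_gt0 e0 k0).
  exists (d * k); first by rewrite mulr_gt0.
  move=> v vA vu vd.
  have vu0 : v - u != 0 by rewrite subr_eq0.
  have vuk : v / k != u / k.
    by apply/eqP => /(congr1 (fun x => x * k)); rewrite !divfK// => /eqP; exact/negP.
  have /(_ _)/= := dd _ (dom _ vA) vuk.
  rewrite -mulrBl normrM (gtr0_norm (_ : 0 < k^-1)) ?invr_gt0// ltr_pdivrMr//.
  move=> /(_ vd) H; rewrite -(ltr_pM2r k0); apply: le_lt_trans H.
  rewrite -[X in _ * X](gtr0_norm k0) -normrM le_eqVlt; apply/orP; left.
  apply/eqP; congr (`|_|); set l := deriv_on _ _ _; field.
  by rewrite kn0 vu0.
split; first by move=> u /E[].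
exists (`|k|^-1 * (K * `|k|^-1 `^ rho)) => u v uA vA.
have [_ ->] := E _ uA; have [_ ->] := E _ vA.
rewrite -mulrBr normrM -!mulrA normfV ler_wpM2l//.
apply: le_trans (psiK _ _ (dom _ uA) (dom _ vA)) _.
by rewrite -mulrBl normrM normfV powRM ?invr_ge0// [X in K * X]mulrC.
Qed.

End scaling.

(** The left branch of [f] multiplied by [s]: the one-parameter family in which
    all perturbations are made. It moves the singular value [f(c-)] to
    [s * f(c-)] and keeps the fixed point 0. *)
Definition scale_left {R : realType} (c s : R) (f : R -> R) (x : R) : R :=
  if x < c then s * f x else f x.

Section scaled_maps.
Context {R : realType} {rho c alpha beta : R}.
Local Notation L := (lorenz_map rho c alpha beta).
Local Notation dom := (lorenz_dom c).
Local Notation lphi f := (left_phi rho c alpha f).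
Local Notation rphi f := (right_phi rho c beta f).
Implicit Types (f g h : L) (x y z e s : R).

Lemma scale_left1 f : scale_left c 1 f = f.
Proof. by apply/funext => x; rewrite /scale_left mul1r; case: ifP. Qed.

Let slope_factor s x : R := if x < c then s else 1.

Let side_near x : x != c -> exists2 r : R, 0 < r &
  forall y, `|y - x| < r -> (y < c) = (x < c).
Proof.
move=> xc; exists `|x - c|; first by rewrite normr_gt0 subr_eq0.
move=> y; have [xltc|cltx|/eqP] := ltgtP x c; last by rewrite (negbTE xc).
  by rewrite [ltRHS]ltr0_norm ?subr_lt0// ltr_norml => /andP[_ ?]; lra.
rewrite [ltRHS]gtr0_norm ?subr_gt0// ltr_norml => /andP[? _].
by apply/negbTE; rewrite -leNgt; lra.
Qed.

Lemma scale_left_deriv f s x : dom x ->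
  derivable_on dom (scale_left c s f) x /\
  deriv_on dom (scale_left c s f) x = slope_factor s x * deriv_on dom f x.
Proof.
move=> domx; have /lorenz_domP[_ xc] := domx.
apply: (@deriv_on_germ _ _ dom) => //; first exact: (limit_point_dom f).
  have [r r0 side] := side_near xc; exists r => // y /side yx domy; split => //.
  by rewrite /scale_left /slope_factor yx; case: ifP => // _; rewrite mul1r.
exact: lorenz_derivable.
Qed.

Lemma left_value_gt0 f : 0 < left_value c f.
Proof.
have [_ _ _ /andP[c0 c1]] := lorenz_params f.
have [sigma sig1 fsig] := lorenz_expanding (lorenz_expands (lorenz_mapP f)).
have [||z /andP[z0 zc] [zc' fE]] := @left_ext_MVT _ _ _ _ _ f 0 c (lexx _) c0.
- exact: ltW.
- by rewrite lexx ltW.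
have dz : dom z by apply/lorenz_domP; split => //; lra.
have f0 := lorenz_0 (lorenz_expands (lorenz_mapP f)).
move: fE; rewrite left_ext_c left_extE ?lt_eqF// f0 !subr0 => ->.
by rewrite mulr_gt0// (lt_le_trans _ (fsig _ dz))// (lt_trans ltr01).
Qed.

Lemma scale_left_branch f s : 0 < s <= 1 ->
  left_branch rho c alpha (scale_left c s f) (s * left_value c f)
    (fun x => s `^ alpha^-1 * lphi f x).
Proof.
have [_ /andP[al0 _] _ /andP[c0 c1]] := lorenz_params f.
move=> /andP[s0 s1]; have d0 := left_value_gt0 f.
have k0 : 0 < s `^ alpha^-1 by rewrite powR_gt0.
have kn0 := lt0r_neq0 k0.
have [dI [C1phi [surj inj onto] [psi psiK C1psi]] phic phiE fE] :=
  left_branch_phi f.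
have D0 : 0 < left_value c f `^ alpha^-1 by rewrite powR_gt0.
have DE : (s * left_value c f) `^ alpha^-1 =
    s `^ alpha^-1 * left_value c f `^ alpha^-1 by rewrite powRM// ltW.
split.
- have /andP[dI0 dI1] := dI.
  by rewrite mulr_ge0 ?(ltW s0)//= mulr_ile1// ltW.
- rewrite DE; split.
  + have [] := @C1holder_scale _ rho `[0, c]%classic (s `^ alpha^-1) (lphi f) => //.
    by move=> x xI; apply: limit_point_itv => //; move: xI; rewrite /= in_itv.
  + split.
    * move=> x /surj; rewrite /= !in_itv/= => /andP[x0 x1].
      by rewrite mulr_ge0 ?(ltW k0)//= ler_pM2l.
    * by move=> x y xI yI /(mulfI kn0); exact: inj.
    * move=> u; rewrite /= in_itv/= => /andP[u0 u1].
      have [|x xI xE] := onto (u / s `^ alpha^-1).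
        by rewrite /= in_itv/= divr_ge0 ?(ltW k0)//= ler_pdivrMr// mulrC.
      by exists x => //=; rewrite xE mulrC divfK.
  + exists (fun u => psi (u / s `^ alpha^-1)).
      by move=> x xI; rewrite mulrAC mulfV// mul1r psiK.
    exact: C1holder_scale_dom.
- by rewrite phic mulr0.
- by rewrite phiE DE.
- move=> x /andP[x0 xc]; rewrite /scale_left xc fE ?x0//.
  rewrite powRM ?(ltW k0) ?left_phi_ge0 ?x0 ?ltW// -powRrM mulVf ?gt_eqF// powRr1 ?ltW//.
  by ring.
Qed.

Lemma scale_left_right_branch f s d phi :
  right_branch rho c beta (scale_left c s f) d phi <->
  right_branch rho c beta f d phi.
Proof.
have E x : c < x <= 1 -> scale_left c s f x = f x.
  by move=> /andP[cx _]; rewrite /scale_left ltNge ltW.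
by split=> -[? ? ? ? H]; split => // x xI; rewrite -?H ?E.
Qed.

(** [s <= 1] keeps the values in the unit interval; the map remains expanding as
    long as [s] times the expansion constant exceeds 1. *)
Lemma scale_left_class f s : 0 < s <= 1 ->
  (exists2 sigma : R, 1 < s * sigma &
    forall x, dom x -> sigma <= deriv_on dom f x) ->
  lorenz_class rho c alpha beta (scale_left c s f).
Proof.
move=> s01 [sigma sig1 fsig]; have /andP[s0 s1] := s01.
have [_ _ _ /andP[c0 c1]] := lorenz_params f.
have fP := lorenz_mapP f; have fexp := lorenz_expands fP.
have sf0 x : 0 <= slope_factor s x.
  by rewrite /slope_factor; case: ifP => // _; exact: ltW.
split; first exact: lorenz_exponents fP.
- split.
  + exact: lorenz_sing fexp.
  + move=> x /(lorenz_junk fexp) fx; rewrite /scale_left fx mulr0.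
    by case: ifP.
  + move=> x domx; have /andP[fx0 fx1] := lorenz_range fexp domx.
    rewrite /scale_left; case: ifP => _; last by rewrite fx0.
    by rewrite mulr_ge0 ?(ltW s0)//= mulr_ile1// ltW.
  + split; first by move=> x /(scale_left_deriv f s)[].
    move=> x domx; have [_ /(_ _ domx)[e e0 [K fK]]] := lorenz_C1 fexp.
    have /lorenz_domP[_ xc] := domx.
    have [r r0 side] := side_near xc.
    exists (Num.min e r); first by rewrite lt_min e0.
    exists (slope_factor s x * K) => y z [domy yb] [domz zb].
    have [_ ->] := scale_left_deriv f s domy.
    have [_ ->] := scale_left_deriv f s domz.
    move: yb zb; rewrite /ball/= !lt_min => /andP[ye yr] /andP[ze zr].
    rewrite /slope_factor side 1?distrC// side 1?distrC//.
    rewrite -/(slope_factor s x) -mulrBr normrM ger0_norm// -mulrA ler_wpM2l//.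
    exact: fK.
  + by rewrite /scale_left c0 (lorenz_0 fexp) mulr0.
  + by rewrite /scale_left ltNge (ltW c1) (lorenz_1 fexp).
  + have [sigma' sig'1 fsig'] := lorenz_expanding fexp.
    exists (Num.min (s * sigma) sigma'); first by rewrite lt_min sig1.
    move=> x domx; have [_ ->] := scale_left_deriv f s domx.
    rewrite /slope_factor ge_min; case: ifP => _.
      by rewrite ler_pM2l// fsig.
    by rewrite mul1r fsig' ?orbT.
  + apply/cvgryPge => A.
    have /cvgryPge/(_ (A / s)) fA := lorenz_deriv_left fexp.
    near=> x.
    have xc : x < c by [].
    have x0 : 0 < x by near: x; exact: nbhs_left_gt.
    have domx : dom x by apply/lorenz_domP; rewrite lt_eqF//; split => //; lra.
    have [_ ->] := scale_left_deriv f s domx.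
    by rewrite /slope_factor xc mulrC -ler_pdivrMr//; near: x.
  + apply/cvgryPge => A.
    have /cvgryPge/(_ A) fA := lorenz_deriv_right fexp.
    near=> x.
    have xc : c < x by [].
    have x1 : x < 1 by near: x; exact: nbhs_right_lt.
    have domx : dom x by apply/lorenz_domP; rewrite gt_eqF//; split => //; lra.
    have [_ ->] := scale_left_deriv f s domx.
    by rewrite /slope_factor ltNge (ltW xc) mul1r; near: x.
- by do 2 eexists; exact: scale_left_branch.
- have [d dphi] := right_phiP f.
  by exists d, (rphi f); exact/scale_left_right_branch.
Unshelve. all: by end_near. Qed.

Lemma lorenz_left_cvg f : f x @[x --> c^'-] --> left_value c f.
Proof.
have [_ _ _ /andP[c0 c1]] := lorenz_params f.
have cI : 0 <= c <= 1 by rewrite !ltW.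
apply/cvgrPdist_lt => e e0; have [d d0 dd] := left_ext_continuous f cI e0.
near=> x.
have xc : x < c by [].
have x0 : 0 < x by near: x; exact: nbhs_left_gt.
have xd : c - d < x by near: x; apply: nbhs_left_gt; rewrite gtrBl.
rewrite distrC -left_ext_c -(@left_extE _ _ _ _ _ f x) ?lt_eqF//; apply: dd.
- by lra.
- by rewrite lexx ltW.
- by rewrite distrC gtr0_norm ?subr_gt0//; lra.
Unshelve. all: by end_near. Qed.

Section scaled_map.
Context (f g : L) (s : R) (s01 : 0 < s <= 1)
  (gE : lorenz_fun g = scale_left c s f).

Lemma scale_left_value : left_value c g = s * left_value c f.
Proof.
have [_ _ _ /andP[c0 c1]] := lorenz_params f.
apply: (@cvg_lim R) => //.
apply: cvg_trans (cvgM (cvg_cst s) (@lorenz_left_cvg f)).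
apply: near_eq_cvg; near=> x.
have xc : x < c by [].
by rewrite gE /scale_left xc.
Unshelve. all: by end_near. Qed.

Lemma scale_right_value : right_value c g = right_value c f.
Proof.
rewrite /right_value; congr (lim _).
apply/seteqP; split; apply: near_eq_cvg; near=> x;
  have xc : c < x by [].
  by rewrite gE /scale_left ltNge (ltW xc).
by rewrite gE /scale_left ltNge (ltW xc).
Unshelve. all: by end_near. Qed.

Lemma scale_left_phi x : 0 <= x <= c -> lphi g x = s `^ alpha^-1 * lphi f x.
Proof.
have [_ /andP[al0 _] _ /andP[c0 c1]] := lorenz_params f.
have /andP[s0 s1] := s01.
have k0 : 0 < s `^ alpha^-1 by rewrite powR_gt0.
move=> xI; apply: (powR_injective al0); rewrite ?nnegrE ?left_phi_ge0//.
  by rewrite mulr_ge0 ?(ltW k0) ?left_phi_ge0.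
have ext : left_ext c g x = s * left_ext c f x.
  have [->|xc] := eqVneq x c; first by rewrite !left_ext_c scale_left_value.
  rewrite !left_extE// gE /scale_left; case: ifP => // /negbT.
  by rewrite -leNgt => cx; case/andP: xI => _ xlec; rewrite eq_le xlec cx in xc.
rewrite powRM ?(ltW k0) ?left_phi_ge0// -powRrM mulVf ?gt_eqF// powRr1 ?(ltW s0)//.
by move: ext; rewrite !left_ext_left// scale_left_value; lra.
Qed.

Lemma scale_right_phi : rphi g = rphi f.
Proof.
rewrite /right_phi gE; congr get; apply/seteqP.
by split=> phi [d] /scale_left_right_branch H; exists d.
Qed.

End scaled_map.

(** The family is Lipschitz for the metric, because its left diffeomorphisms are
    all proportional to the one of [f]. *)
Lemma scale_left_dist f : exists2 M : R, 0 <= M &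
  forall s t (g h : L), 0 < s <= 1 -> 0 < t <= 1 ->
    lorenz_fun g = scale_left c s f -> lorenz_fun h = scale_left c t f ->
    lorenz_dist g h <= M * `|s - t|.
Proof.
have [/andP[rho0 _] al _ /andP[c0 c1]] := lorenz_params f.
have /andP[al0 _] := al.
have [dphi [K phiK]] := left_C1 f.
have [M0 M00 HM0] := C1holder_bounded rho0 c0 (left_C1 f).
have [M1 M10 HM1] := C1holder_deriv_bounded rho0 c0 (left_C1 f).
have N0 : 0 <= M0 + M1 + `|K| by rewrite !addr_ge0.
have acc x : `[0, c]%classic x -> limit_point_of `[0, c]%classic x.
  by move=> xI; apply: limit_point_itv => //; move: xI; rewrite /= in_itv.
exists (1 + alpha^-1 * (M0 + M1 + `|K|)).
  by rewrite addr_ge0// mulr_ge0// invr_ge0 ltW.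
move=> s t g h s01 t01 gE hE.
rewrite /lorenz_dist (scale_left_value gE) (scale_left_value hE).
rewrite (scale_right_value gE) (scale_right_value hE) subrr normr0 addr0.
rewrite (scale_right_phi gE) (scale_right_phi hE).
have -> : C1holder_norm rho `[c, 1]%classic (rphi f \- rphi f) = 0.
  have d0 x : `[c, 1]%classic x -> deriv_on `[c, 1] (rphi f \- rphi f) x = 0.
    move=> xI; have [dr _] := right_C1 f.
    rewrite deriv_onB ?subrr//; [|exact: dr|exact: dr].
    by apply: limit_point_itv => //; move: xI; rewrite /= in_itv.
  apply/eqP; rewrite eq_le C1holder_norm_ge0 andbT.
  have := @C1holder_norm_le _ rho `[c, 1]%classic (rphi f \- rphi f) 0 0 0
    (lexx _) (lexx _) (lexx _); rewrite !addr0; apply.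
  - by move=> x _ /=; rewrite subrr normr0.
  - by move=> x xI; rewrite d0// normr0.
  - by move=> x y xI yI; rewrite !d0// subrr normr0 mul0r.
rewrite addr0 mulrDl mul1r -mulrBl normrM.
set k := s `^ alpha^-1 - t `^ alpha^-1.
have kst : `|k| <= alpha^-1 * `|s - t| by exact: powR_inv_lipschitz.
have /andP[dv0 dv1] := left_value_itv f.
apply: lerD; first by rewrite ler_piMr// ger0_norm.
have E x : `[0, c]%classic x ->
    derivable_on `[0, c] (lphi g \- lphi h) x /\
    deriv_on `[0, c] (lphi g \- lphi h) x = k * deriv_on `[0, c] (lphi f) x.
  move=> xI; apply: (@deriv_on_germ _ _ `[0, c]%classic) => //; last exact: dphi.
    exact: acc.
  exists 1 => // y _ yI; split => //=.
  have {}yI : 0 <= y <= c by move: yI; rewrite /= in_itv.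
  by rewrite (scale_left_phi s01 gE)// (scale_left_phi t01 hE)// -mulrBl.
apply: (@le_trans _ _ (`|k| * M0 + `|k| * M1 + `|k| * `|K|)); last first.
  by rewrite -!mulrDr mulrAC ler_wpM2r.
apply: C1holder_norm_le; rewrite ?mulr_ge0//.
- move=> x; rewrite /= in_itv/= => xI.
  rewrite (scale_left_phi s01 gE)// (scale_left_phi t01 hE)// -mulrBl normrM.
  by rewrite ler_wpM2l// HM0.
- move=> x xI; have [_ ->] := E _ xI; by rewrite normrM ler_wpM2l// HM1.
- move=> x y xI yI; have [_ ->] := E _ xI; have [_ ->] := E _ yI.
  rewrite -mulrBr normrM -mulrA ler_wpM2l//.
  by rewrite (le_trans (phiK _ _ xI yI))// ler_wpM2r ?powR_ge0 ?ler_norm.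
Qed.

End scaled_maps.

(** * Periodic orbits passing close to the singularity *)

(** There is a periodic orbit avoiding the singularity whose Lyapunov exponent is
    at least [M]. The derivative at the single point [p] is required to exceed
    [exp (n M)] already; this suffices since all derivatives are above 1. *)
Definition high_periodic {R : realType} (c : R) (f : R -> R) (M : R) : Prop :=
  exists (n : nat) (p : R),
  [/\ (0 < n)%N, iter n f p = p, forall j, lorenz_dom c (iter j f p) &
    expR (n%:R * M) <= deriv_on (lorenz_dom c) f p].


Section dynamics.
Context {R : realType} {rho c alpha beta : R}.
Local Notation L := (lorenz_map rho c alpha beta).
Local Notation dom := (lorenz_dom c).
Local Notation lphi f := (left_phi rho c alpha f).
Local Notation T f := (left_ext c (lorenz_fun f)).
Implicit Types (f g h : L) (x y z e s : R) (n j : nat).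

Lemma lorenz_distxx f : lorenz_dist f f = 0.
Proof. exact: (mdistxx f). Qed.

Lemma lorenz_distC f g : lorenz_dist f g = lorenz_dist g f.
Proof. exact: (metric_sym f g). Qed.

Lemma lorenz_dist_triangle g f h :
  lorenz_dist f h <= lorenz_dist f g + lorenz_dist g h.
Proof. exact: (metric_triangle f g h). Qed.

Lemma iter_left_ext_itv f x n : 0 <= x <= 1 -> 0 <= iter n (T f) x <= 1.
Proof. by move=> x01; elim: n => //= n IH; exact: left_ext_itv. Qed.

Lemma same_side (u v : R) : u != c -> `|v - u| < `|u - c| ->
  (v <= c) = (u <= c) /\ v != c.
Proof.
have [ultc|cltu|] := ltgtP u c => // _.
  rewrite [ltRHS]ltr0_norm ?subr_lt0// ltr_norml => /andP[_ ?].
  by have vc : v < c by [lra]; rewrite (ltW vc) lt_eqF.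
rewrite [ltRHS]gtr0_norm ?subr_gt0// ltr_norml => /andP[? _].
by have vc : c < v by [lra]; rewrite leNgt vc gt_eqF.
Qed.

(** Iterates depend continuously on the map and on the initial point, as long
    as the orbit does not come back to the singularity. *)
Lemma iter_left_ext_close g x n : 0 <= x <= 1 ->
  (forall j, (0 < j < n)%N -> iter j (T g) x != c) ->
  forall e : R, 0 < e -> exists2 d : R, 0 < d & forall h y,
    lorenz_dist h g < d -> 0 <= y <= 1 -> (y <= c) = (x <= c) ->
    `|y - x| < d -> `|iter n (T h) y - iter n (T g) x| < e.
Proof.
have [_ al be /andP[c0 c1]] := lorenz_params g.
move=> x01; elim: n => [_ e e0|n IH xn e e0].
  by exists e => // h y _ _ _.
set u := iter n (T g) x.
have u01 : 0 <= u <= 1 by exact: iter_left_ext_itv.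
have e20 : 0 < e / 2 by rewrite divr_gt0.
have [d1 d10 H1] := left_ext_continuous g u01 e20.
have [d2 d20 H2] := @left_ext_close R rho c alpha beta al be _ e20.
have [d d0 Hd] : exists2 d : R, 0 < d & forall h y,
    lorenz_dist h g < d -> 0 <= y <= 1 -> (y <= c) = (x <= c) ->
    `|y - x| < d -> `|iter n (T h) y - u| < d1 /\
    (iter n (T h) y <= c) = (u <= c).
  have {}IH : forall e : R, 0 < e -> exists2 d : R, 0 < d & forall h y,
      lorenz_dist h g < d -> 0 <= y <= 1 -> (y <= c) = (x <= c) ->
      `|y - x| < d -> `|iter n (T h) y - u| < e.
    by apply: IH => j /andP[j0 jn]; apply: xn; rewrite j0 ltnS ltnW.
  case: (posnP n) => [n0|n0].
    exists d1 => // h y _ _ yx yd.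
    by rewrite /u n0 /= yd.
  have uc : u != c by apply: xn; rewrite n0 ltnSn.
  have m0 : 0 < Num.min d1 `|u - c| by rewrite lt_min d10 normr_gt0 subr_eq0.
  have [d d0 Hd] := IH _ m0; exists d => // h y hd y01 yx yd.
  have := Hd h y hd y01 yx yd; rewrite lt_min => /andP[-> /(same_side uc)[-> _]].
  by [].
exists (Num.min d d2); first by rewrite lt_min d0.
move=> h y; rewrite lt_min => /andP[hd hd2] y01 yx.
rewrite lt_min => /andP[yd _].
have [v1 v2] := Hd h y hd y01 yx yd.
rewrite !iterS -/u; set v := iter n (T h) y in v1 v2 *.
have v01 : 0 <= v <= 1 by exact: iter_left_ext_itv.
rewrite -(subrK (T g v) (T h v)) -addrA (le_lt_trans (ler_normD _ _))//.
by rewrite [e]splitr ltrD// ?H2// H1.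
Qed.

(** Points close to [x] have under all maps close to [g] the itinerary of [x], up
    to time [n]. *)
Lemma iter_left_ext_side g x n : 0 <= x <= 1 ->
  (forall j, (0 < j < n)%N -> iter j (T g) x != c) ->
  exists2 d : R, 0 < d & forall h y, lorenz_dist h g < d ->
    0 <= y <= 1 -> (y <= c) = (x <= c) -> `|y - x| < d ->
    forall j, (0 < j < n)%N ->
      (iter j (T h) y <= c) = (iter j (T g) x <= c) /\ iter j (T h) y != c.
Proof.
move=> x01; elim: n => [_|n IH xn].
  by exists 1 => // h y _ _ _ _ j; rewrite ltn0 andbF.
have [|d d0 Hd] := IH; first by move=> j /andP[j0 jn]; apply: xn; rewrite j0 ltnS ltnW.
case: (posnP n) => [n0|n0].
  by exists 1 => // h y _ _ _ _ j; rewrite n0 ltnS; case: j.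
have uc : iter n (T g) x != c by apply: xn; rewrite n0 ltnSn.
have uc0 : 0 < `|iter n (T g) x - c| by rewrite normr_gt0 subr_eq0.
have [|d' d'0 Hd'] := @iter_left_ext_close g x n x01 _ _ uc0.
  by move=> j /andP[j0 jn]; apply: xn; rewrite j0 ltnS ltnW.
exists (Num.min d d'); first by rewrite lt_min d0.
move=> h y; rewrite lt_min => /andP[hd hd'] y01 yx; rewrite lt_min => /andP[yd yd'] j.
case/andP => j0; rewrite ltnS leq_eqVlt => /predU1P[->|jn].
  exact: (same_side uc (Hd' h y hd' y01 yx yd')).
by apply: Hd => //; rewrite j0.
Qed.

Lemma left_ext_expand f (m : R) x y : 0 <= x -> x < y -> y <= 1 ->
  (x <= c) = (y <= c) ->
  (forall z, x < z < y -> dom z -> m <= deriv_on dom f z) ->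
  m * (y - x) <= T f y - T f x.
Proof.
move=> x0 xy y1 xyc fm.
have [z zI [zc ->]] := left_ext_MVT f x0 xy y1 xyc.
rewrite ler_pM2r ?subr_gt0//; apply: fm => //.
by apply/lorenz_domP; split => //; lra.
Qed.

Lemma lorenz_deriv_gt1 f x : dom x -> 1 < deriv_on dom f x.
Proof.
have [sigma sig1 fsig] := lorenz_expanding (lorenz_expands (lorenz_mapP f)).
by move=> /fsig; exact: lt_le_trans.
Qed.

Lemma left_ext_dist_ge f x y : 0 <= x <= 1 -> 0 <= y <= 1 -> x <= y ->
  (x <= c) = (y <= c) -> y - x <= T f y - T f x.
Proof.
move=> /andP[x0 _] /andP[_ y1]; rewrite le_eqVlt => /predU1P[->|xy xyc].
  by rewrite !subrr.
rewrite -[y - x]mul1r; apply: left_ext_expand => // z _ /(lorenz_deriv_gt1 f).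
exact: ltW.
Qed.

(** Maps close to [g] have a left branch as steep as wanted near [c]. *)
Lemma left_deriv_near g (A : R) : exists2 d : R, 0 < d <= c & forall h x,
  lorenz_dist h g < d -> c - d < x < c -> A <= deriv_on dom h x.
Proof.
have [_ /andP[al0 al1] _ /andP[c0 c1]] := lorenz_params g.
wlog A0 : A / 0 < A => [H|].
  have [d d0 Hd] := H (`|A| + 1) (ltr_wpDl (normr_ge0 _) ltr01).
  exists d => // h x hd xd; apply: le_trans (Hd h x hd xd).
  by rewrite (le_trans (ler_norm A))// lerDl.
have [m [d1 m0 [d10 Hd1]]] := left_phi_deriv_near g.
have al10 : 0 < 1 - alpha by rewrite subr_gt0.
(* the threshold t solves alpha t^(alpha - 1) m / 2 = A *)
pose t : R := (alpha * (m / 2) / A) `^ (1 - alpha)^-1.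
have q0 : 0 < alpha * (m / 2) / A by rewrite !divr_gt0// mulr_gt0// divr_gt0.
have t0 : 0 < t by rewrite powR_gt0.
have tE : t `^ (1 - alpha) = alpha * (m / 2) / A.
  by rewrite /t -powRrM mulVf ?gt_eqF// powRr1// ltW.
have t20 : 0 < t / 2 by rewrite divr_gt0.
have m20 : 0 < m / 2 by rewrite divr_gt0.
have cI : `[0, c]%classic c by rewrite /= in_itv/= lexx ltW.
have [dphi _] := left_C1 g.
have [d2 d20 Hd2] := derivable_on_continuous (dphi _ cI) t20.
have [_ _ phic _ _] := left_branch_phi g; rewrite phic in Hd2.
exists (Num.min (Num.min d1 d2) (Num.min c (Num.min (t / 2) (m / 2)))).
  by rewrite !lt_min d10 d20 c0 t20 m20/= !ge_min lexx !orbT.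
set d := Num.min _ _; move=> h x hd /andP[xd xc].
have /and5P[dd1 dd2 dc dt dm] :
    [&& d <= d1, d <= d2, d <= c, d <= t / 2 & d <= m / 2].
  by rewrite /d !ge_min !lexx !orbT.
have xd1 : c - d1 <= x <= c by lra.
have [x0 phi'] := Hd1 _ xd1.
have xp : 0 < x < c by lra.
have xI : 0 <= x <= c by lra.
have [_ H1 H2] := lorenz_dist_left hd xI.
have phig : `|lphi g x - 0| < t / 2.
  apply: Hd2; first by rewrite /= in_itv.
  by rewrite ltr0_norm ?subr_lt0//; lra.
have phih0 : 0 < lphi h x by apply: left_phi_gt0; lra.
have phiht : lphi h x <= t.
  by move: H1 phig; rewrite subr0 !ltr_norml => /andP[_ ?] /andP[_ ?]; lra.
apply: le_trans (left_deriv_ge h xp).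
have phih' : m / 2 <= - deriv_on `[0, c] (lphi h) x.
  by move: H2; rewrite ltr_norml => /andP[? ?]; lra.
apply: (@le_trans _ _ (alpha * lphi h x `^ (alpha - 1) * (m / 2))); last first.
  by rewrite ler_pM2l// mulr_gt0// powR_gt0.
have -> : alpha - 1 = - (1 - alpha) by ring.
rewrite powRN mulrAC ler_pdivlMr ?powR_gt0//.
have : lphi h x `^ (1 - alpha) <= t `^ (1 - alpha).
  by apply: ge0_ler_powR => //; rewrite ?nnegrE ltW.
by rewrite tE ler_pdivlMr// mulrC.
Qed.

(** Suppose the singular value of [g] returns to the singularity at time [n].
    Every map [h] close to [g] for which it returns beyond [c] has a periodic
    point just on the left of [c], where the derivative is huge while the
    period remains [n]. *)
Lemma connection_high_periodic g n (M : R) : (0 < n)%N ->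
  iter n (T g) c = c -> (forall j, (0 < j < n)%N -> iter j (T g) c != c) ->
  exists2 d : R, 0 < d & forall h, lorenz_dist h g < d ->
    c < iter n (T h) c -> high_periodic c h M.
Proof.
have [_ _ _ /andP[c0 c1]] := lorenz_params g.
have c01 : 0 <= c <= 1 by rewrite !ltW.
move=> n0 gc gn.
have [d1 /andP[d10 d1c] H1] := left_deriv_near g (expR (n%:R * M) + 2).
have [d2 d20 H2] := iter_left_ext_side c01 gn.
pose r := Num.min d1 d2 / 2.
have m0 : 0 < Num.min d1 d2 by rewrite lt_min d10.
have r0 : 0 < r by rewrite divr_gt0.
have [m1 m2] : Num.min d1 d2 <= d1 /\ Num.min d1 d2 <= d2.
  by rewrite !ge_min !lexx orbT.
have [rd1 rd2] : r < d1 /\ r < d2 by rewrite /r; split; lra.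
have [d3 d30 H3] := iter_left_ext_close c01 gn r0.
exists (Num.min d1 (Num.min d2 d3)); first by rewrite !lt_min d10 d20.
move=> h; rewrite !lt_min => /and3P[hd1 hd2 hd3] hc.
have near_c y : c - r <= y <= c ->
    [/\ 0 <= y <= 1, (y <= c) = (c <= c) & `|y - c| < d2].
  move=> /andP[y1 y2]; split; [lra|by rewrite y2 lexx|].
  by rewrite distrC ger0_norm ?subr_ge0//; lra.
have side y : c - r <= y <= c -> forall j, (0 < j < n)%N ->
    (iter j (T h) y <= c) = (iter j (T g) c <= c) /\ iter j (T h) y != c.
  by move=> /near_c[y01 yc yd] j jn; exact: H2.
have tiny : iter n (T h) c < c + r.
  have := H3 h c hd3 c01 erefl; rewrite subrr normr0 gc => /(_ d30).
  by rewrite ltr_norml => /andP[_]; lra.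
have lo : c - r <= c - r <= c by lra.
have [y01 _ _] := near_c _ lo.
(* the image of [c - r, c] is at least twice as long as the interval *)
have grow j : (j < n)%N -> 2 * r <= iter j.+1 (T h) c - iter j.+1 (T h) (c - r).
  elim: j => [_|j IH jn].
    rewrite /= [X in _ * X <= _](_ : r = c - (c - r)); last by ring.
    apply: left_ext_expand; rewrite ?lexx//; [lra|lra|lra|lra|].
    move=> z /andP[z1 z2] _; apply: (@le_trans _ _ (expR (n%:R * M) + 2)).
      by rewrite lerDr expR_ge0.
    by apply: H1 => //; lra.
  apply: le_trans (IH (ltnW jn)) _; rewrite !(iterS j.+1).
  have cc : c - r <= c <= c by lra.
  apply: left_ext_dist_ge; rewrite ?iter_left_ext_itv//.
    by have := IH (ltnW jn); lra.
  have [-> _] := side _ lo j.+1 jn.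
  by have [-> _] := side _ cc j.+1 jn.
have below : iter n (T h) (c - r) < c - r.
  by have := grow n.-1; rewrite prednK// => /(_ (leqnn _)); lra.
pose G y := iter n (T h) y - y.
have contG : {within `[c - r, c], continuous G}.
  apply: within_continuousP => y; rewrite /= in_itv/= => yI e e0.
  have [yJ _ _] := near_c _ yI.
  have e20 : 0 < e / 2 by rewrite divr_gt0.
  have [d d0 Hd] := @iter_left_ext_close h y n yJ
    (fun j jn => proj2 (side y yI j jn)) _ e20.
  exists (Num.min d (e / 2)); first by rewrite lt_min d0.
  move=> z; rewrite in_itv/= => zI; rewrite lt_min => /andP[zd ze].
  have [zJ zc _] := near_c _ zI; have [_ yc _] := near_c _ yI.
  have := Hd h z; rewrite lorenz_distxx => /(_ d0 zJ _ zd).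
  rewrite zc yc => /(_ erefl) H; rewrite /G.
  rewrite [X in `|X|](_ : _ = iter n (T h) z - iter n (T h) y - (z - y)).
    2: by ring.
  by rewrite (le_lt_trans (ler_normB _ _))// [e]splitr ltrD.
have [||p + Gp] := @IVT R G (c - r) c 0 _ contG; first by lra.
  by rewrite ge_min le_max /G; apply/andP; split; apply/orP; [left|right]; lra.
rewrite in_itv/= => pI; have pE : iter n (T h) p = p by move: Gp; rewrite /G; lra.
have pc : p != c by apply/eqP => pc; move: hc; rewrite pc in pE; rewrite pE ltxx.
have pr : p != c - r by apply/eqP => pr; move: below; rewrite pr in pE; rewrite pE ltxx.
have {}pI : c - r < p < c.
  by move/andP: pI => [p1 p2]; rewrite !lt_def p1 p2 pr eq_sym pc.
have pI' : c - r <= p <= c by lra.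
have [p01 _ _] := near_c _ pI'.
have orbit j : iter j (T h) p != c.
  have -> : iter j (T h) p = iter (j %% n) (T h) p.
    rewrite {1}(divn_eq j n) addnC iterD; congr iter.
    by elim: (j %/ n)%N => //= k IH; rewrite mulSn iterD IH.
  have jn : (j %% n < n)%N by rewrite ltn_mod.
  have [->//|j0] := posnP (j %% n)%N.
  by have [] := side p pI' (j %% n)%N; rewrite ?j0.
have iterE j : iter j h p = iter j (T h) p.
  by elim: j => //= j ->; rewrite left_extE.
exists n, p; split => //; first by rewrite iterE.
  by move=> j; rewrite iterE; apply/lorenz_domP; split => //; exact: iter_left_ext_itv.
apply: (@le_trans _ _ (expR (n%:R * M) + 2)); first by rewrite lerDl.
by apply: H1 => //; lra.
Qed.

(** Explicit form of the completed maps of the scaled family. *)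
Lemma scale_left_ext f g s : lorenz_fun g = scale_left c s f ->
  forall x, T g x = (if x <= c then s else 1) * T f x.
Proof.
move=> gE x; have [->|xc] := eqVneq x c.
  by rewrite !left_ext_c (scale_left_value gE) lexx.
rewrite !left_extE// gE /scale_left le_eqVlt (negbTE xc)/=.
by case: ifP; rewrite ?mul1r.
Qed.

(** In the family of the maps [f] with left branch multiplied by [s], the
    singular value falls on the singularity after finitely many steps for some
    parameter [s] of any given interval: otherwise its iterates for the two extreme
    parameters would remain on the same side of [c] and move apart exponentially. *)
Lemma scale_left_connection f (a b sigma : R) : 0 < a -> a < b -> b <= 1 ->
  1 < a * sigma -> (forall x, dom x -> sigma <= deriv_on dom f x) ->
  let F s x := (if x <= c then s else 1) * T f x in
  exists s n, [/\ a <= s <= b, (0 < n)%N, iter n (F s) c = c &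
    forall j, (0 < j < n)%N -> iter j (F s) c != c].
Proof.
have [_ _ _ /andP[c0 c1]] := lorenz_params f.
have c01 : 0 <= c <= 1 by rewrite !ltW.
move=> a0 ab b1 tau1 fsig F.
have [dv0 dv1] : 0 < left_value c f /\ left_value c f <= 1.
  by split; [exact: left_value_gt0|have /andP[] := left_value_itv f].
suff [s [n [sI n0 sn]]] : exists s n,
    [/\ a <= s <= b, (0 < n)%N & iter n (F s) c = c].
  have exn : exists n, (0 < n)%N && (iter n (F s) c == c).
    by exists n; rewrite n0 sn eqxx.
  case: (ex_minnP exn) => m /andP[m0 /eqP mc] min_m.
  exists s, m; split => // j /andP[j0 jm]; apply/negP => jc.
  by have := min_m j; rewrite j0 jc leqNgt jm => /(_ isT).
apply: contrapT => noret.
have {}noret s n : a <= s <= b -> (0 < n)%N -> iter n (F s) c != c.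
  by move=> sI n0; apply/eqP => sc; apply: noret; exists s, n.
have F01 s x : a <= s <= b -> 0 <= x <= 1 -> 0 <= F s x <= 1.
  move=> sI x01; have /andP[Tx0 Tx1] := left_ext_itv f x01.
  rewrite /F; case: ifP => _; last by rewrite mul1r Tx0.
  have s0 : 0 <= s by lra.
  by rewrite mulr_ge0//= mulr_ile1//; lra.
pose X n s := iter n (F s) c.
have X01 n s : a <= s <= b -> 0 <= X n s <= 1.
  by move=> sI; rewrite /X; elim: n => //= n IH; exact: F01.
have X1 s : X 1%N s = s * left_value c f by rewrite /X /= /F lexx left_ext_c.
have XS n s : X n.+1 s = F s (X n s) by rewrite /X iterS.
have {}noret s n : a <= s <= b -> (0 < n)%N -> X n s != c by exact: noret.
clearbody X.
have contX n : {within `[a, b], continuous (X n.+1)}.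
  elim: n => [|n IH]; apply: within_continuousP => s; rewrite /= in_itv/= => sI e e0.
    exists e => // t _ ts; rewrite !X1 -mulrBl normrM (gtr0_norm dv0).
    by rewrite (le_lt_trans _ ts)// ler_piMr.
  set u := X n.+1 s; have u01 : 0 <= u <= 1 by exact: X01.
  have uc : u != c by exact: noret.
  have e20 : 0 < e / 2 by rewrite divr_gt0.
  have [d1 d10 H1] := left_ext_continuous f u01 e20.
  have m0 : 0 < Num.min d1 `|u - c| by rewrite lt_min d10 normr_gt0 subr_eq0.
  have /subspace_continuousP/(_ s)/= := IH; rewrite in_itv/= => /(_ sI).
  move=> /cvgrPdist_lt/(_ _ m0)[d /= d0 Hd].
  exists (Num.min d (e / 2)); first by rewrite lt_min d0.
  move=> t; rewrite in_itv/= => tI; rewrite lt_min => /andP[td te].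
  have := Hd t; rewrite /= distrC in_itv/= => /(_ td tI).
  rewrite distrC lt_min => /andP[v1 /(same_side uc)[v2 _]].
  set v := X n.+1 t in v1 v2.
  have v01 : 0 <= v <= 1 by exact: X01.
  rewrite (XS n.+1 t) (XS n.+1 s) -/u -/v /F v2.
  have HT := H1 v v01 v2 v1.
  have /andP[Tv0 Tv1] := left_ext_itv f v01.
  case: ifP => _.
    2: by rewrite !mul1r (lt_trans HT)// ltr_pdivrMr// ltr_pMr// ltr1n.
  have -> : t * T f v - s * T f u = (t - s) * T f v + s * (T f v - T f u) by ring.
  rewrite (le_lt_trans (ler_normD _ _))// [e]splitr ltrD// normrM.
    by rewrite (le_lt_trans _ te)// ler_piMr// ger0_norm.
  by rewrite (le_lt_trans _ HT)// ler_piMl// ger0_norm; lra.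
have same n : (X n.+1 a <= c) = (X n.+1 b <= c).
  have aI : a <= a <= b by lra.
  have bI : a <= b <= b by lra.
  have [na nb] := (noret a n.+1 aI isT, noret b n.+1 bI isT).
  apply: contrapT => /eqP side.
  have [||s] := @IVT R (X n.+1) a b c _ (contX n); first exact: ltW.
    rewrite ge_min le_max; move: side na nb.
    by have [?|?|_] := ltgtP (X n.+1 a) c; have [?|?|_] := ltgtP (X n.+1 b) c;
      rewrite ?orbT// => side; case: side.
  by rewrite in_itv/= => sI sc; have := noret s n.+1 sI isT; rewrite sc eqxx.
have grow n : (a * sigma) ^+ n * ((b - a) * left_value c f) <= X n.+1 b - X n.+1 a.
  elim: n => [|n IH]; first by rewrite expr0 mul1r !X1; lra.
  have aI : a <= a <= b by lra.
  have bI : a <= b <= b by lra.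
  rewrite exprS -mulrA.
  have tau0 : 0 < a * sigma by lra.
  apply: le_trans (ler_wpM2l (ltW tau0) IH) _.
  rewrite (XS n.+1 b) (XS n.+1 a) /F same.
  have [u01 v01] := (X01 n.+1 a aI, X01 n.+1 b bI).
  have uv : X n.+1 a < X n.+1 b.
    rewrite -subr_gt0; apply: lt_le_trans IH.
    by rewrite !mulr_gt0 ?subr_gt0// exprn_gt0.
  have := same n.
  set u := X n.+1 a in u01 uv *; set v := X n.+1 b in v01 uv *; move=> side.
  have H : sigma * (v - u) <= T f v - T f u.
    by apply: left_ext_expand => //; [lra|lra|move=> z _ /fsig].
  have /andP[Tv0 Tv1] := left_ext_itv f v01.
  have sig0 : 0 < sigma by rewrite -(pmulr_rgt0 _ a0).
  case: ifP => _.
    apply: (@le_trans _ _ (a * (T f v - T f u))).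
      by rewrite -mulrA ler_pM2l.
    by rewrite mulrBr lerD2r ler_wpM2r// ltW.
  rewrite !mul1r (le_trans _ H)// ler_pM2r ?subr_gt0// ler_piMl//; first exact: ltW.
  lra.
have K0 : 0 < (b - a) * left_value c f by rewrite mulr_gt0// subr_gt0.
have [n nB] := expn_unbounded ((b - a) * left_value c f)^-1 tau1.
have aI : a <= a <= b by lra.
have bI : a <= b <= b by lra.
have := grow n; have := X01 n.+1 a aI; have := X01 n.+1 b bI.
move: nB; rewrite -(ltr_pM2r K0) mulVf ?gt_eqF//; lra.
Qed.

(** Arbitrarily close to [f] there is an open set of maps with periodic orbits
    of large exponent: first create a connection of the singularity, then open
    it by increasing the singular value slightly further. *)
Lemma high_periodic_perturbation f (M e : R) : 0 < e ->
  exists2 g : L, lorenz_dist f g < e &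
    exists2 d : R, 0 < d & forall h, lorenz_dist g h < d -> high_periodic c h M.
Proof.
have [_ _ _ /andP[c0 c1]] := lorenz_params f.
have c01 : 0 <= c <= 1 by rewrite !ltW.
move=> e0.
have [sigma sig1 fsig] := lorenz_expanding (lorenz_expands (lorenz_mapP f)).
have sig0 : 0 < sigma := lt_trans ltr01 sig1.
have [C C0 distC] := scale_left_dist f.
have C10 : 0 < C + 1 by rewrite ltr_wpDl.
have isig1 : sigma^-1 < 1 by rewrite invf_lt1.
have isig0 : 0 < sigma^-1 by rewrite invr_gt0.
(* parameters in [a, 1] give expanding maps at distance less than e from f *)
pose r := Num.min ((1 - sigma^-1) / 2) (e / 2 / (C + 1)).
have r0 : 0 < r by rewrite lt_min !divr_gt0// subr_gt0.
have [r1 r2] : r <= (1 - sigma^-1) / 2 /\ r <= e / 2 / (C + 1).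
  by rewrite !ge_min !lexx !orbT.
pose a := 1 - r.
have a0 : 0 < a by rewrite /a; lra.
have tau1 : 1 < a * sigma by rewrite -ltr_pdivrMr// mul1r /a; lra.
have mapP s : a <= s <= 1 -> exists g : L, lorenz_fun g = scale_left c s f.
  move=> sI.
  have sP : lorenz_class rho c alpha beta (scale_left c s f).
    apply: scale_left_class; first by lra.
    exists sigma => //; apply: lt_le_trans tau1 _.
    by rewrite ler_pM2r//; lra.
  by exists (LorenzMap sP).
have farP s g : a <= s <= 1 -> lorenz_fun g = scale_left c s f ->
    lorenz_dist f g < e.
  move=> sI gE.
  have /= := distC 1 s f g _ _ (esym (scale_left1 f)) gE.
  rewrite ltr01 lexx => /(_ isT) H; apply: le_lt_trans (H _) _; first by lra.
  rewrite ger0_norm ?subr_ge0; last by lra.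
  apply: (@le_lt_trans _ _ (C * r)).
    by rewrite ler_wpM2l//; move: sI; rewrite /a; lra.
  apply: (@le_lt_trans _ _ (e / 2)); last by lra.
  by move: r2; rewrite ler_pdivlMr// mulrDr mulr1 mulrC; lra.
(* g0 has a connection: its singular value returns to c exactly *)
have [||s [n [sI n0 sn sj]]] :=
  @scale_left_connection f a (1 - r / 2) sigma a0 _ _ tau1 fsig.
- by rewrite /a; lra.
- by lra.
have sI1 : a <= s <= 1 by lra.
have [g0 g0E] := mapP _ sI1.
have iterE j : iter j (T g0) c =
    iter j (fun x => (if x <= c then s else 1) * T f x) c.
  by elim: j => //= j ->; rewrite (scale_left_ext g0E).
have gc : iter n (T g0) c = c by rewrite iterE.
have gn j : (0 < j < n)%N -> iter j (T g0) c != c by rewrite iterE; exact: sj.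
have [d0 d00 H0] := @connection_high_periodic g0 n M n0 gc gn.
have [d1 d10 H1] := iter_left_ext_side c01 gn.
pose u := Num.min (r / 4) (Num.min (d0 / 2) (d1 / 2) / (C + 1)).
have m0 : 0 < Num.min (d0 / 2) (d1 / 2) by rewrite lt_min !divr_gt0.
have u0 : 0 < u by rewrite lt_min !divr_gt0.
have [u1 u2] : u <= r / 4 /\ u <= Num.min (d0 / 2) (d1 / 2) / (C + 1).
  by rewrite !ge_min !lexx !orbT.
have tI : a <= s + u <= 1 by lra.
have [g gE] := mapP _ tI.
have gg0 : lorenz_dist g g0 <= Num.min (d0 / 2) (d1 / 2).
  apply: le_trans (distC (s + u) s g g0 _ _ gE g0E) _; [lra|lra|].
  rewrite addrAC subrr add0r gtr0_norm//.
  by move: u2; rewrite ler_pdivlMr// mulrDr mulr1 mulrC; lra.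
have [gd0 gd1] : lorenz_dist g g0 <= d0 / 2 /\ lorenz_dist g g0 <= d1 / 2.
  by move: gg0; rewrite le_min => /andP[].
have gd1' : lorenz_dist g g0 < d1.
  by rewrite (le_lt_trans gd1)// ltr_pdivrMr// ltr_pMr// ltr1n.
have side j : (0 < j < n)%N -> (iter j (T g) c <= c) = (iter j (T g0) c <= c) /\
    iter j (T g) c != c.
  by apply: H1; rewrite ?subrr ?normr0.
have mono j : (j < n)%N -> iter j.+1 (T g0) c < iter j.+1 (T g) c.
  elim: j => [_|j IH jn].
    rewrite /= (scale_left_ext g0E) (scale_left_ext gE) lexx.
    by rewrite ltr_pM2r ?ltrDl// left_ext_c left_value_gt0.
  rewrite !(iterS j.+1) (scale_left_ext g0E) (scale_left_ext gE).
  have [sideE _] := side j.+1 jn; rewrite sideE.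
  have {IH} := IH (ltnW jn); have xI := iter_left_ext_itv g0 j.+1 c01.
  have yI := iter_left_ext_itv g j.+1 c01.
  set x := iter j.+1 (T g0) c in xI sideE *; set y := iter j.+1 (T g) c in yI sideE *.
  move=> xy; have := left_ext_dist_ge f xI yI (ltW xy) (esym sideE) => Txy.
  have /andP[Ty0 Ty1] := left_ext_itv f yI.
  have lt_T : T f x < T f y by rewrite -subr_gt0 (lt_le_trans _ Txy)// subr_gt0.
  have s0 : 0 < s by case/andP: sI => /(lt_le_trans a0).
  case: ifP => _; last by rewrite !mul1r.
  apply: (@lt_le_trans _ _ (s * T f y)); first by rewrite ltr_pM2l.
  by rewrite ler_wpM2r// lerDl ltW.
(* the singular value of g now returns beyond c *)
have gt_c : c < iter n (T g) c.
  by have := mono n.-1; rewrite prednK// gc; apply.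
have gn' j : (0 < j < n)%N -> iter j (T g) c != c by move=> /side[].
have e'0 : 0 < iter n (T g) c - c by rewrite subr_gt0.
have [d2 d20 H2] := iter_left_ext_close c01 gn' e'0.
exists g; first exact: (farP (s + u)).
exists (Num.min (d0 / 2) d2); first by rewrite lt_min divr_gt0.
move=> h; rewrite lt_min lorenz_distC => /andP[hd0 hd2]; apply: H0.
  apply: le_lt_trans (lorenz_dist_triangle g h g0) _.
  by rewrite [d0]splitr ltr_leD.
have := H2 h c hd2 c01 erefl; rewrite subrr normr0 => /(_ d20).
by rewrite ltr_norml opprB ltrD2r => /andP[].
Qed.

End dynamics.

(** * Entropy of a mixture with a finite orbit *)

Section entropy_of_mixtures.
Context {R : realType}.
Local Notation Rm := (measurableTypeR R).
Implicit Types (mu : probability Rm R) (A : set Rm) (t : R).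

Lemma fine_probability_itv mu A : measurable A -> 0 <= fine (mu A) <= 1.
Proof.
move=> mA; rewrite fine_ge0//=.
by rewrite -lee_fin fineK ?fin_num_measure// probability_le1.
Qed.

Lemma sum_probability_le1 mu (I : finType) (A : I -> set Rm) :
  (forall i, measurable (A i)) -> trivIset setT A ->
  \sum_i fine (mu (A i)) <= 1.
Proof.
move=> mA tA; rewrite -lee_fin -sumEFin.
rewrite (eq_bigr (fun i => mu (A i))); last by move=> i _; rewrite fineK// fin_num_measure.
rewrite big_enum_val/=.
rewrite -(@measure_semi_additive_ord _ _ _ mu _ (fun j => A (enum_val j))) //.
- by apply: probability_le1; exact: bigsetU_measurable.
- apply/trivIsetP => i j _ _ ij; move/trivIsetP : tA; apply => //.
  by apply: contra_neq ij; exact: enum_val_inj.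
- exact: bigsetU_measurable.
Qed.

(** Fraction of the points [x 0, ..., x (n - 1)] that lie in [A]. *)
Definition visit_frequency n (x : nat -> R) A : R :=
  n%:R^-1 * \sum_(i < n) \1_A (x i).

Lemma visit_frequency_ge0 n x A : 0 <= visit_frequency n x A.
Proof.
by rewrite mulr_ge0 ?invr_ge0// sumr_ge0// => i _; rewrite indicE.
Qed.

Lemma visit_frequency_ge n x A i : (i < n)%N -> A (x i) ->
  n%:R^-1 <= visit_frequency n x A.
Proof.
move=> ni Axi; rewrite -[leLHS]mulr1 ler_wpM2l ?invr_ge0//.
rewrite (bigD1 (Ordinal ni))//= indicE mem_set// lerDl sumr_ge0//.
Qed.

Lemma visit_frequency_gap n x A :
  visit_frequency n x A = 0 \/ n%:R^-1 <= visit_frequency n x A.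
Proof.
have [[i [ni Axi]]|noA] := pselect (exists i, (i < n)%N /\ A (x i)).
  by right; exact: visit_frequency_ge Axi.
left; rewrite /visit_frequency big1 ?mulr0// => i _.
by rewrite indicE memNset// => Axi; apply: noA; exists i.
Qed.

(** Mixture of a probability with the uniform one on a finite sequence. *)
Lemma mixture_probability mu n x t : (0 < n)%N -> 0 <= t <= 1 ->
  exists m : probability Rm R, forall A, measurable A ->
    fine (m A) = (1 - t) * fine (mu A) + t * visit_frequency n x A.
Proof.
move=> n0 /andP[t0 t1]; have n0' : 0 < n%:R :> R by rewrite ltr0n.
have t'0 : 0 <= 1 - t by rewrite subr_ge0.
have tn0 : 0 <= t / n%:R by rewrite divr_ge0.
pose orb : {measure set Rm -> \bar R} := msum (fun i => \d_(x i : Rm)) n.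
pose m0 : {measure set Rm -> \bar R} :=
  measure_add (mscale (NngNum t'0) mu) (mscale (NngNum tn0) orb).
have m0E A : measurable A ->
    m0 A = ((1 - t) * fine (mu A) + t * visit_frequency n x A)%:E.
  move=> mA; rewrite [m0 A](measure_addE (mscale (NngNum t'0) mu)
    (mscale (NngNum tn0) orb)) /= /mscale /= /orb /= /msum.
  rewrite [RHS]EFinD [((1 - t) * _)%:E]EFinM fineK ?fin_num_measure//; congr (_ + _)%E.
  by rewrite /visit_frequency mulrA [RHS]EFinM -sumEFin.
(* normalization only supplies the probability structure: m0 has mass 1 *)
exists (mnormalize m0 mu) => A mA.
have m01 : m0 setT = 1%E.
  rewrite m0E// probability_setT /= mulr1 /visit_frequency.
  rewrite (eq_bigr (fun=> 1)); last by move=> i _; rewrite indicE in_setT.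
  by rewrite sumr_const card_ord mulVf ?gt_eqF// mulr1 subrK.
rewrite /= /mnormalize m01/= onee_eq0 /= invr1 mule1.
by rewrite m0E.
Qed.

Lemma xlnx_itv (y : R) : 0 <= y <= 1 -> -1 <= y * ln y <= 0.
Proof.
move=> /andP[y0 y1]; have [->|yn0] := eqVneq y 0; first by rewrite mul0r lerN10 lexx.
have {}y0 : 0 < y by rewrite lt_def yn0.
rewrite pmulr_rle0// ln_le0// andbT.
have iy0 : 0 < y^-1 by rewrite invr_gt0.
have := ln_sublinear iy0; rewrite lnV ?posrE// => H.
by move/ltW: H; rewrite -(ler_pM2l y0) mulfV// mulrN; lra.
Qed.

(** Contribution of one atom, of measures [x] and [y]: the first term of the bound
    accounts for the atoms missed by the orbit; those visited by it are few and
    contribute at most 2 each. *)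
Lemma entropy_term_mixture t (x y : R) n : 0 < t < 1 -> 0 <= x <= 1 ->
  0 <= y <= 1 -> (0 < n)%N -> y = 0 \/ n%:R^-1 <= y ->
  forall z, z = (1 - t) * x + t * y ->
  `|z * ln z - (1 - t) * (x * ln x)| <= `|ln (1 - t)| * x + 2 * n%:R * y.
Proof.
move=> /andP[t0 t1] x01 y01 n0 yE z zE; have /andP[x0 x1] := x01.
have /andP[y0 y1] := y01.
have t'0 : 0 < 1 - t by rewrite subr_gt0.
have n0' : 0 < n%:R :> R by rewrite ltr0n.
case: yE => [yE|ny].
  rewrite zE yE !mulr0 !addr0; have [->|xn0] := eqVneq x 0.
    by rewrite !(mulr0, mul0r) subrr normr0.
  have {}x0 : 0 < x by rewrite lt_def xn0.
  rewrite lnM ?posrE// (_ : _ - _ = (1 - t) * (ln (1 - t) * x)); last by ring.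
  rewrite normrM ger0_norm ?(ltW t'0)// normrM (ger0_norm (ltW x0)).
  by rewrite ler_piMl ?mulr_ge0 ?(ltW x0)//; lra.
have z01 : 0 <= z <= 1.
  have a0 : 0 <= (1 - t) * x by rewrite mulr_ge0// ltW.
  have b0 : 0 <= t * y by rewrite mulr_ge0// ltW.
  rewrite zE addr_ge0//=.
  have a1 : (1 - t) * x <= 1 - t by rewrite ler_piMr// ltW.
  have b1 : t * y <= t by rewrite ler_piMr// ltW.
  by lra.
have /andP[z1 z2] := xlnx_itv z01; have /andP[w1 w2] := xlnx_itv x01.
apply: (@le_trans _ _ 2).
  have w3 : (1 - t) * (x * ln x) <= 0 by rewrite pmulr_rle0.
  have w4 : -1 <= (1 - t) * (x * ln x).
    by apply: le_trans w1 _; rewrite ler_niMl//; lra.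
  by rewrite ler_norml; apply/andP; split; lra.
apply: (@le_trans _ _ (2 * n%:R * y)).
  by rewrite -mulrA ler_peMr// mulrC -ler_pdivrMr// mul1r.
by rewrite lerDr mulr_ge0.
Qed.

(** Mixing in a finite orbit multiplies the entropy of every finite partition
    by [1 - t], up to a constant independent of the partition. *)
Lemma partition_entropy_mixture mu (m : probability Rm R) n x t
    (I : finType) (A : I -> set Rm) : (0 < n)%N -> 0 < t < 1 ->
  (forall B, measurable B ->
    fine (m B) = (1 - t) * fine (mu B) + t * visit_frequency n x B) ->
  (forall i, measurable (A i)) -> trivIset setT A ->
  `|partition_entropy m A - (1 - t) * partition_entropy mu A|
    <= `|ln (1 - t)| + 2 * n%:R / t.
Proof.
move=> n0 t01 mE mA tA; have /andP[t0 t1] := t01.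
pose nu i := visit_frequency n x (A i).
have mu1 := sum_probability_le1 mu mA tA.
have nu1 : \sum_i nu i <= t^-1.
  rewrite -(ler_pM2l t0) mulfV ?gt_eqF// mulr_sumr.
  apply: le_trans (sum_probability_le1 m mA tA); apply: ler_sum => i _.
  rewrite mE// lerDr mulr_ge0 ?subr_ge0 ?(ltW t1)//.
  by have /andP[] := fine_probability_itv mu (mA i).
have nu01 i : 0 <= nu i <= 1.
  rewrite visit_frequency_ge0/= /nu /visit_frequency ler_pdivrMl ?ltr0n// mulr1.
  by rewrite -[leRHS](mulr1 n%:R) mulr_natl -[n in leRHS]card_ord -sumr_const ler_sum.
rewrite /partition_entropy mulrN -opprD normrN mulr_sumr -sumrB.
apply: le_trans (ler_norm_sum _ _ _) _.
apply: (@le_trans _ _ (\sum_i (`|ln (1 - t)| * fine (mu (A i)) + 2 * n%:R * nu i))).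
  apply: ler_sum => i _; rewrite mE//; apply: entropy_term_mixture => //.
    exact: fine_probability_itv.
  exact: visit_frequency_gap.
rewrite big_split/= -2!mulr_sumr lerD//.
  by rewrite ler_piMr.
by rewrite ler_wpM2l.
Qed.

End entropy_of_mixtures.

(** * Invariant probabilities with large exponent *)

Section exponents_and_entropy.
Context {R : realType} {rho c alpha beta : R}.
Local Notation L := (lorenz_map rho c alpha beta).
Local Notation dom := (lorenz_dom c).
Local Notation Rm := (measurableTypeR R).
Implicit Types (f : L) (mu m : probability Rm R) (x : nat -> R) (t : R).

Lemma measurable_lorenz_dom : measurable (dom : set Rm).
Proof. by apply: measurableD; [exact: measurable_itv|exact: measurable_set1]. Qed.

Lemma measurable_lorenz_preimage f (B : set Rm) : measurable B ->
  measurable (lorenz_preimage c f B : set Rm).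
Proof.
move=> mB; have : measurable_fun (dom : set Rm) (f : R -> Rm); last first.
  by apply => //; exact: measurable_lorenz_dom.
apply: subspace_continuous_measurable_fun; first exact: measurable_lorenz_dom.
apply: within_continuousP => x domx e e0.
have dx : derivable_on dom f x by exact: lorenz_derivable.
by have [d d0 dd] := derivable_on_continuous dx e0; exists d.
Qed.

Lemma measurable_ln_deriv f :
  measurable_fun (dom : set Rm) (fun z : Rm => (ln (deriv_on dom f (z : R)))%:E).
Proof.
apply/measurable_EFinP; apply: (measurableT_comp (@measurable_ln R)).
apply: subspace_continuous_measurable_fun; first exact: measurable_lorenz_dom.
have [/andP[rho0 _] _ _ _] := lorenz_params f.
apply: within_continuousP => x domx e e0.
have [_ /(_ x domx)[d d0 [K fK]]] := lorenz_C1 (lorenz_expands (lorenz_mapP f)).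
have K0 : 0 < `|K| + 1 by rewrite ltr_wpDl.
have r0 : 0 < (e / (`|K| + 1)) `^ rho^-1 by rewrite powR_gt0// divr_gt0.
exists (Num.min d ((e / (`|K| + 1)) `^ rho^-1)); first by rewrite lt_min d0.
move=> y domy; rewrite lt_min => /andP[yd yr].
have xb : (dom `&` ball x d) x by split => //; exact: ballxx.
have yb : (dom `&` ball x d) y by split => //; rewrite /ball/= distrC.
apply: le_lt_trans (fK _ _ yb xb) _.
apply: (@le_lt_trans _ _ (`|K| * `|y - x| `^ rho)).
  by rewrite ler_wpM2r ?powR_ge0 ?ler_norm.
have pe : `|y - x| `^ rho < e / (`|K| + 1).
  by apply: powR_lt_root => //; rewrite divr_gt0.
apply: (@le_lt_trans _ _ ((`|K| + 1) * `|y - x| `^ rho)).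
  by rewrite ler_wpM2r ?powR_ge0// lerDl.
by rewrite mulrC -ltr_pdivlMr.
Qed.

Lemma measurable_iter_preimage f (B : set Rm) i : measurable B ->
  measurable (iter i (lorenz_preimage c f) B : set Rm).
Proof.
by move=> mB; elim: i => //= i IH; exact: measurable_lorenz_preimage.
Qed.

Lemma measurable_refined_partition f k (P : 'I_k -> set Rm) n w :
  measurable_partition P ->
  measurable (refined_partition c f P (n := n) w : set Rm).
Proof.
move=> [mP _ _]; apply: fin_bigcap_measurable => // i _.
exact: measurable_iter_preimage.
Qed.

Lemma trivIset_refined_partition f k (P : 'I_k -> set Rm) n :
  measurable_partition P ->
  trivIset setT (refined_partition c f P (n := n)).
Proof.
move=> [_ tP _] v w _ _ [y [vy wy]]; apply/ffunP => i.
have {}vy := vy i I; have {}wy := wy i I; move: vy wy.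
suff : forall (j : nat) (y : R), iter j (lorenz_preimage c f) (P (v i)) y ->
    iter j (lorenz_preimage c f) (P (w i)) y -> v i = w i by exact.
elim=> [z vz wz|j IH z /= [_ vz] [_ wz]]; last exact: IH vz wz.
by apply: tP => //; exists z.
Qed.

(** No convergence is assumed: the two sequences converge or diverge together, and
    in the latter case both limits take the default value 0. *)
Lemma lim_shrink (u v : nat -> R) (t C : R) : 0 < t < 1 ->
  (forall n, `|n%:R^-1 * u n - (1 - t) * (n%:R^-1 * v n)| <= n%:R^-1 * C) ->
  limn (fun n => n%:R^-1 * u n) = (1 - t) * limn (fun n => n%:R^-1 * v n).
Proof.
move=> /andP[t0 t1] uv.
have t'0 : 1 - t != 0 by rewrite subr_eq0 gt_eqF.
set U := fun n => n%:R^-1 * u n; set V := fun n => n%:R^-1 * v n.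
have d0 : U n - (1 - t) * V n @[n --> \oo] --> (0 : R).
  apply/cvgr0Pnorm_lt => e e0.
  near=> n.
  have nC : (`|C| + 1) / e < n%:R by near: n; exact: nbhs_infty_gtr.
  have n0 : 0 < n%:R :> R.
    by apply: le_lt_trans nC; rewrite divr_ge0// ltW// ltW.
  apply: le_lt_trans (uv n) _; rewrite mulrC ltr_pdivrMr//.
  move: nC; rewrite ltr_pdivrMr// mulrC => nC.
  by apply: le_lt_trans nC; rewrite (le_trans (ler_norm C))// lerDl.
have [cV|dV] := pselect (cvg (V n @[n --> \oo])).
  apply: (@cvg_lim R) => //.
  have : U n - (1 - t) * V n + (1 - t) * V n @[n --> \oo] -->
      0 + (1 - t) * limn V by apply: cvgD => //; apply: cvgM => //; exact: cvg_cst.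
  rewrite add0r; under eq_fun do rewrite subrK; exact.
have dU : ~ cvg (U n @[n --> \oo]).
  move=> cU; apply: dV; apply/cvg_ex; exists ((1 - t)^-1 * (limn U - 0)).
  have : (1 - t)^-1 * (U n - (U n - (1 - t) * V n)) @[n --> \oo] -->
      (1 - t)^-1 * (limn U - 0).
    by apply: cvgM; [exact: cvg_cst|exact: cvgB].
  by under eq_fun do rewrite opprB addrCA subrr addr0 mulKf//.
have p0 : (point : R) = 0 by reflexivity.
by rewrite (dvgP dU) (dvgP dV) p0 mulr0.
Unshelve. all: by end_near. Qed.

(** By [partition_entropy_mixture] the difference of the entropies of the refined
    partitions is bounded, hence negligible after division by the time. *)
Lemma entropy_wrt_mixture f mu m n x t k (P : 'I_k -> set Rm) :
  (0 < n)%N -> 0 < t < 1 -> measurable_partition P ->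
  (forall B, measurable B ->
    fine (m B) = (1 - t) * fine (mu B) + t * visit_frequency n x B) ->
  entropy_wrt c f m P = (1 - t) * entropy_wrt c f mu P.
Proof.
move=> n0 t01 pP mE.
apply: (@lim_shrink _ _ _ (`|ln (1 - t)| + 2 * n%:R / t)) => // N.
rewrite mulrCA -mulrBr normrM ger0_norm ?invr_ge0// ler_wpM2l ?invr_ge0//.
apply: (partition_entropy_mixture n0 t01 mE).
  by move=> w; exact: measurable_refined_partition.
exact: trivIset_refined_partition.
Qed.

Lemma probability_eq mu m (A B : set Rm) : measurable A -> measurable B ->
  fine (mu A) = fine (m B) -> mu A = m B.
Proof.
by move=> mA mB AB; rewrite -[LHS]fineK ?fin_num_measure// AB fineK ?fin_num_measure.
Qed.

Lemma invariant_mixture f mu m n p t : (0 < n)%N -> iter n f p = p ->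
  (forall j, dom (iter j f p)) -> invariant_probability c f mu ->
  (forall B, measurable B ->
    fine (m B) = (1 - t) * fine (mu B) +
      t * visit_frequency n (fun j => iter j f p) B) ->
  invariant_probability c f m.
Proof.
move=> n0 fp orb [mu1 muI] mE.
have m01 : measurable (`[0, 1]%classic : set Rm) by exact: measurable_itv.
have n0' : n%:R != 0 :> R by rewrite pnatr_eq0 -lt0n.
split.
  rewrite -mu1; apply: probability_eq => //; rewrite mE// mu1/=.
  rewrite /visit_frequency (eq_bigr (fun=> 1)); last first.
    by move=> i _; rewrite indicE mem_set//; have [] := orb i.
  by rewrite sumr_const card_ord mulVf// !mulr1 subrK.
move=> B mB B01; have mfB := measurable_lorenz_preimage f mB.
apply: probability_eq => //; rewrite !mE// (muI _ mB B01); congr (_ + _ * (_ * _)).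
have shift i : \1_(lorenz_preimage c f B) (iter i f p) = \1_B (iter i.+1 f p) :> R.
  rewrite !indicE; congr (_%:R : R); congr nat_of_bool.
  apply/idP/idP; rewrite !inE; first by case.
  by move=> fB; split => //; exact: orb.
under eq_bigr do rewrite shift.
case: n n0 fp {mE n0'} => // n _ fp.
by move: fp => /= fp; rewrite big_ord_recr big_ord_recl/= fp addrC.
Qed.

Lemma lyapunov_exponent_ge f m (z : R) : dom z ->
  ((ln (deriv_on dom f z))%:E * m [set z] <= lyapunov_exponent c f m)%E.
Proof.
move=> domz.
have mz : measurable ([set z] : set Rm) by exact: measurable_set1.
pose F (y : Rm) : \bar R := (ln (deriv_on dom f (y : R)))%:E.
have Fz : (\int[m]_(y in [set z]) F y = (ln (deriv_on dom f z))%:E * m [set z])%E.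
  rewrite -(integral_cst m mz); apply: eq_integral => y.
  by rewrite inE => ->.
rewrite -Fz; change (\int[m]_(y in [set z]) F y <= \int[m]_(y in dom) F y)%E.
apply: ge0_subset_integral => //.
- exact: measurable_lorenz_dom.
- exact: measurable_ln_deriv.
- by move=> y domy; rewrite lee_fin ln_ge0// ltW// lorenz_deriv_gt1.
- by move=> y ->.
Qed.

(** Mixing any invariant probability with a small proportion of an orbit of
    huge exponent makes the exponent large and barely lowers the entropy. *)
Lemma high_periodic_entropy f (lambda : R) : 0 < lambda ->
  (forall K : nat, high_periodic c f K%:R) ->
  topological_entropy c f =
  ereal_sup [set metric_entropy c f mu
            | mu in [set mu | invariant_probability c f mu /\
                (lambda%:E <= lyapunov_exponent c f mu)%E]].
Proof.
move=> l0 fK; set S := ereal_sup [set _ | _ in [set mu | _ /\ _]].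
apply/eqP; rewrite eq_le; apply/andP; split; last first.
  by apply: le_ereal_sup => _ [mu [muI _] <-]; exists mu.
apply: ge_ereal_sup => _ [mu muI <-]; apply: ge_ereal_sup => _ [k [P [pP ->]]].
set h := entropy_wrt c f mu P.
have mix t : 0 < t < 1 -> (((1 - t) * h)%:E <= S)%E.
  move=> t01; have /andP[t0 t1] := t01.
  have [n [p [n0 fp orb Dp]]] := fK (Num.bound (lambda / t)).
  have tI : 0 <= t <= 1 by rewrite !ltW.
  have [m mE] := mixture_probability mu (fun j => iter j f p) n0 tI.
  have mI := invariant_mixture n0 fp orb muI mE.
  rewrite -(entropy_wrt_mixture f n0 t01 pP mE).
  apply: (@le_trans _ _ (metric_entropy c f m)); apply: ereal_sup_ubound.
    by exists k, P.
  exists m => //; split => //.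
  have domp : dom p := orb 0%N.
  apply: le_trans (lyapunov_exponent_ge f m domp).
  have mp : measurable ([set p] : set Rm) by exact: measurable_set1.
  rewrite -[m _]fineK ?fin_num_measure// -EFinM lee_fin.
  have n0' : 0 < n%:R :> R by rewrite ltr0n.
  have lnD : n%:R * (Num.bound (lambda / t))%:R <= ln (deriv_on dom f p).
    rewrite -[leLHS]expRK ler_ln// posrE ?expR_gt0//.
    by apply: lt_le_trans Dp; exact: expR_gt0.
  have bd : lambda / t < (Num.bound (lambda / t))%:R.
    by apply: archi_boundP; rewrite divr_ge0// ltW.
  have mp_ge : t / n%:R <= fine (m [set p]).
    rewrite mE//; have : n%:R^-1 <= visit_frequency n (fun j => iter j f p) [set p].
      exact: (@visit_frequency_ge _ n _ _ 0%N).
    rewrite -(ler_pM2l t0) => H; rewrite (le_trans H)// lerDr mulr_ge0//.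
      by rewrite subr_ge0 ltW.
    by have /andP[] := fine_probability_itv mu mp.
  apply: (@le_trans _ _ (n%:R * (Num.bound (lambda / t))%:R * (t / n%:R))).
    rewrite [n%:R * _]mulrC -mulrA [n%:R * _]mulrC divfK ?gt_eqF//.
    by move: bd; rewrite ltr_pdivrMr// => /ltW.
  by apply: ler_pM => //; rewrite divr_ge0// ltW.
case ES : S mix => [r| |] mix; [|by rewrite leey|]; last first.
  have half : 0 < (2^-1 : R) < 1 by lra.
  by have := mix _ half.
rewrite lee_fin; apply/ler_addgt0Pr => e e0.
have h0 : 0 < `|h| + 1 by rewrite ltr_wpDl.
pose t := Num.min 2^-1 (e / (`|h| + 1)).
have t0 : 0 < t by rewrite lt_min invr_gt0 ltr0n divr_gt0.
have t2 : t <= 2^-1 by rewrite ge_min lexx.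
have te : t <= e / (`|h| + 1) by rewrite ge_min lexx orbT.
have t01 : 0 < t < 1 by rewrite t0 (le_lt_trans t2)//; lra.
have := mix _ t01; rewrite lee_fin mulrBl mul1r lerBlDr => H.
apply: le_trans H _; rewrite lerD2l.
apply: (@le_trans _ _ (t * (`|h| + 1))).
  by rewrite ler_wpM2l ?(ltW t0)// (le_trans (ler_norm h))// lerDl.
by rewrite -ler_pdivlMr.
Qed.

End exponents_and_entropy.

(** * Generic Lorenz maps *)

Theorem corollary2 (R : realType) (rho c alpha beta : R)
    (rho01 : 0 < rho < 1) (c01 : 0 < c < 1)
    (alpha01 : 0 < alpha < 1) (beta01 : 0 < beta < 1) :
  residual [set f : lorenz_map rho c alpha beta |
    forall lambda : R, 0 < lambda ->
      topological_entropy c f =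
      ereal_sup [set metric_entropy c f mu
                | mu in [set mu | invariant_probability c f mu /\
                    (lambda%:E <= lyapunov_exponent c f mu)%E]]].
Proof.
pose U (K : nat) := interior [set f : lorenz_map rho c alpha beta |
  high_periodic c f K%:R].
exists U => [K|f Uf lambda l0]; last first.
  by apply: high_periodic_entropy => // K; exact: interior_subset (Uf K I).
split; first exact: open_interior.
move=> V [f Vf] oV.
have /(_ f Vf)[e e0 Ve] := (open_lorenzP V).1 oV.
have [g fg [d d0 gd]] := high_periodic_perturbation f K%:R e0.
exists g; split; first exact: Ve.
by apply/nbhs_ballP; exists d.
Qed.
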